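(* Let $T>0$, and let $Q$, $\tilde Q$, $g_1,\dots,g_p$ be as in the context, satisfying all the standing assumptions listed there. Let $\mathrm{f}:[0,T]\times\mathbb{R}^d\to\mathbb{R}^d$ be a measurable map for which there exist constants $K_{\mathrm f},L_{\mathrm f},H_{\mathrm f}>0$ such that for all $q,\tilde q\in\bigcup_{\tau\in[0,T]}Q(\tau)$ and all $t,s\in[0,T]$: $$|\mathrm f(t,q)-\mathrm f(t,\tilde q)|\le K_{\mathrm f}|q-\tilde q|,\qquad |\mathrm f(t,q)|\le L_{\mathrm f}(1+|q|),\qquad |\mathrm f(t,q)-\mathrm f(s,q)|\le H_{\mathrm f}|t-s|^{1/2}.$$ Let $q_0\in Q(0)$, let $q$ be the solution of the perturbed sweeping process with initial value $q_0$, and for $n\ge1$ let $q^n$ be the discrete solution with time step $h=T/n$ (both defined in the context). Then there exists a constant $C_0>0$ (independent of $n$) such that for all $n$ large enough (i.e. for $h=T/n$ small enough) $$\|q^n-q\|_{L^\infty([0,T])}\le C_0\,h^{1/2}=C_0\left(\frac Tn\right)^{1/2}.$$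
   Context: **Setting.** $\mathbb{R}^d$ carries its Euclidean structure; $|\cdot|$ is the Euclidean norm. For a set $S\subset\mathbb{R}^d$, $d_S(y)=\inf_{z\in S}|y-z|$ and $\mathrm P_S(y)=\{z\in S:\ |y-z|=d_S(y)\}$ (identified with its unique element when it is a singleton, e.g. when $S$ is nonempty closed convex). For $S$ closed and $x\in S$, the proximal normal cone is $\mathrm N(S,x)=\{v\in\mathbb{R}^d:\ \exists a>0,\ x\in \mathrm P_S(x+av)\}$. For $i\in\{1,\dots,p\}$ let $g_i:[0,T]\times\mathbb{R}^d\to\mathbb{R}$ be convex with respect to the second variable. For $t\in[0,T]$ put $$Q_i(t)=\{q\in\mathbb{R}^d:\ g_i(t,q)\ge0\},\qquad Q(t)=\bigcap_{i=1}^pQ_i(t)\ \text{(assumed nonempty)}.$$ **Standing assumptions.** - There are $c>0$ and open sets $U_i(t)\supset Q_i(t)$ such that, for all $t\in[0,T]$ and all $i$, the distance between $Q_i(t)$ and $\mathbb{R}^d\setminus U_i(t)$, i.e. $\inf\{|x-y|:\ x\in Q_i(t),\ y\notin U_i(t)\}$, is $>c$. Put $U(t)=\bigcap_{i=1}^pU_i(t)$. - There are constants $\alpha,\beta,M>0$ such that for all $t\in[0,T]$ and all $i$, $g_i(t,\cdot)\in C^2(U_i(t))$, the time derivatives below exist, and: $\alpha\le|\nabla_qg_i(t,q)|\le\beta$ for $q\in U_i(t)$; $|\partial_tg_i(t,q)|\le\beta$ for $q\in\mathbb{R}^d$; $|\partial_t\nabla_qg_i(t,q)|\le M$ for $q\in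 U_i(t)$; $|\mathrm D_q^2g_i(t,q)|\le M$ for $q\in U_i(t)$. - There are $\gamma\ge1$ and $\rho>0$ such that for all $t\in[0,T]$, all $q\in Q(t)$ and all reals $\lambda_i\ge0$, $$\sum_{i\in I_\rho(t,q)}\lambda_i|\nabla_qg_i(t,q)|\le\gamma\Big|\sum_{i\in I_\rho(t,q)}\lambda_i\nabla_qg_i(t,q)\Big|,\qquad I_\rho(t,q)=\{i\in\{1,\dots,p\}:\ g_i(t,q)\le\rho\}.$$ **Convex approximation.** For $t\in[0,T]$ and $q\in U(t)$, $$\tilde Q(t,q)=\{\tilde q\in\mathbb{R}^d:\ g_i(t,q)+\langle\nabla_qg_i(t,q),\tilde q-q\rangle\ge0\ \ \text{for all } i\in\{1,\dots,p\}\}.$$ **Continuous solution.** $q:[0,T]\to\mathbb{R}^d$ is the (known to be unique) absolutely continuous function with $q(t)\in Q(t)$ for all $t\in[0,T]$, $q(0)=q_0$ and $$\frac{dq}{dt}(t)+\mathrm N(Q(t),q(t))\ni\mathrm f(t,q(t))\quad\text{for a.e. }t\in[0,T].$$ **Discrete solution.** For $n\ge1$ let $h=T/n$, $t^n_k=kh$, $q^n_0=q_0$ and, for $0\le k<n$, $$q^n_{k+1}=\mathrm P_{\tilde Q(t^n_{k+1},q^n_k)}\big(q^n_k+h\,\mathrm f(t^n_k,q^n_k)\big).$$ It is known that for $n$ sufficiently large this scheme is well-defined. The function $q^n:[0,T]\to\mathbb{R}^d$ is the continuous function, affine on each $[t^n_k,t^n_{k+1}]$, with $q^n(t^n_k)=q^n_k$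 for $k=0,\dots,n$. *)

(* Defs.v *)
From HB Require Import structures.
From mathcomp Require Import all_boot all_order all_algebra.
From mathcomp Require Import all_classical all_reals all_analysis.

Set Implicit Arguments.
Unset Strict Implicit.
Unset Printing Implicit Defensive.

Import Order.TTheory GRing.Theory Num.Theory.
Import numFieldNormedType.Exports.

Local Open Scope classical_set_scope.
Local Open Scope ring_scope.

(* The library norm on ['rV[R]_d] is the max norm; it is only used through
   the topology and the differential calculus it induces. All metric
   quantities below use the Euclidean norm [enorm]. *)
Definition dot (R : realType) (d : nat) (u v : 'rV[R]_d) : R :=
  \sum_(j < d) u 0 j * v 0 j.

Definition enorm (R : realType) (d : nat) (u : 'rV[R]_d) : R :=
  Num.sqrt (dot u u).

Definition opnorm (R : realType) (d : nat) (A : 'M[R]_d) : R :=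
  sup [set enorm (v *m A) | v in [set v : 'rV[R]_d | enorm v <= 1]].

Definition dist_to (R : realType) (d : nat) (S : set 'rV[R]_d) (y : 'rV[R]_d)
    : R :=
  inf [set enorm (y - z) | z in S].

Definition projset (R : realType) (d : nat) (S : set 'rV[R]_d) (y : 'rV[R]_d)
    : set 'rV[R]_d :=
  [set z | S z /\ enorm (y - z) = dist_to S y].

(* The element of [projset S y] when this set is a singleton; an element of it
   when it is merely nonempty, and the junk value [y] when it is empty. *)
Definition proj (R : realType) (d : nat) (S : set 'rV[R]_d) (y : 'rV[R]_d)
    : 'rV[R]_d :=
  xget y (projset S y).

Definition prox_normal (R : realType) (d : nat) (S : set 'rV[R]_d)
    (x : 'rV[R]_d) : set 'rV[R]_d :=
  [set v | exists2 a : R, 0 < a & projset S (x + a *: v) x].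

(* Extended-real valued, so that it is [+oo] when [A] or [B] is empty. *)
Definition set_dist (R : realType) (d : nat) (A B : set 'rV[R]_d) : \bar R :=
  ereal_inf [set (enorm (z.1 - z.2))%:E | z in A `*` B].

Definition grad (R : realType) (d : nat) (h : 'rV[R]_d -> R) (q : 'rV[R]_d)
    : 'rV[R]_d :=
  \row_(j < d) 'D_(delta_mx 0 j) h q.

Definition hess (R : realType) (d : nat) (h : 'rV[R]_d -> R) (q : 'rV[R]_d)
    : 'M[R]_d :=
  'J (grad h) q.

(* Meant for open [U], where differentiability and continuity at the points
   of [U] do not depend on the values of [h] outside [U]. *)
Definition C2_on (R : realType) (d : nat) (U : set 'rV[R]_d)
    (h : 'rV[R]_d -> R) : Prop :=
  forall q, U q ->
    [/\ differentiable (h : 'rV[R]_d -> R^o) q, differentiable (grad h) q &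
        {for q, continuous (hess h)}].

(* [l] is the derivative at [t] of [phi : [0, T] -> V], one-sided at the
   end points; the values of [phi] outside [0, T] are ignored. *)
Definition is_tderive (R : realType) (V : normedModType R) (T : R)
    (phi : R -> V) (t : R) (l : V) : Prop :=
  (fun s => (s - t)^-1 *: (phi s - phi t)) @ within `[0, T] t^' --> l.

Definition abs_continuous (R : realType) (d : nat) (T : R)
    (q : R -> 'rV[R]_d) : Prop :=
  forall e : R, 0 < e -> exists2 dl : R, 0 < dl &
    forall (m : nat) (a b : 'I_m -> R),
      (forall j, [/\ 0 <= a j, a j <= b j & b j <= T]) ->
      (forall j k, j != k -> b j <= a k \/ b k <= a j) ->
      \sum_(j < m) (b j - a j) < dl ->
      \sum_(j < m) enorm (q (b j) - q (a j)) < e.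

Definition Qi (R : realType) (d p : nat) (g : 'I_p -> R -> 'rV[R]_d -> R)
    (i : 'I_p) (t : R) : set 'rV[R]_d :=
  [set q | 0 <= g i t q].

Definition Q (R : realType) (d p : nat) (g : 'I_p -> R -> 'rV[R]_d -> R)
    (t : R) : set 'rV[R]_d :=
  \bigcap_(i in [set: 'I_p]) Qi g i t.

Definition Qtilde (R : realType) (d p : nat) (g : 'I_p -> R -> 'rV[R]_d -> R)
    (t : R) (q : 'rV[R]_d) : set 'rV[R]_d :=
  [set q' | forall i, 0 <= g i t q + dot (grad (g i t) q) (q' - q)].

(* The product sigma-algebra on the domain is the Borel one of R * R^d. *)
Definition borel_on (R : realType) (d : nat) (T : R)
    (f : R -> 'rV[R]_d -> 'rV[R]_d) : Prop :=
  let Rd := g_sigma_algebraType (@open 'rV[R]_d) in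
  measurable_fun (`[0, T] `*` [set: Rd] : set (measurableTypeR R * Rd))
    (fun z : measurableTypeR R * Rd => f z.1 z.2 : Rd).

Definition sweeping_solution (R : realType) (d p : nat)
    (g : 'I_p -> R -> 'rV[R]_d -> R) (f : R -> 'rV[R]_d -> 'rV[R]_d)
    (T : R) (q0 : 'rV[R]_d) (q : R -> 'rV[R]_d) : Prop :=
  [/\ abs_continuous T q,
      forall t : R, t \in `[0, T] -> Q g t (q t),
      q 0 = q0 &
      {ae @lebesgue_measure R, forall t : R, t \in `[0, T] ->
         derivable q t 1 /\
         prox_normal (Q g t) (q t) (f t (q t) - q^`()%classic t)}].

Fixpoint scheme (R : realType) (d p : nat) (g : 'I_p -> R -> 'rV[R]_d -> R)
    (f : R -> 'rV[R]_d -> 'rV[R]_d) (h : R) (q0 : 'rV[R]_d) (k : nat)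
    : 'rV[R]_d :=
  if k is k'.+1 then
    let qk := scheme g f h q0 k' in
    proj (Qtilde g (k'.+1%:R * h) qk) (qk + h *: f (k'%:R * h) qk)
  else q0.

(* For [t] in [k h, (k + 1) h[, the affine function taking the value [u k] at
   [k h] and [u k.+1] at [(k + 1) h]; its value at [n h] is [u n], so [u n.+1]
   does not matter on [0, n h]. *)
Definition interpolate (R : realType) (d : nat) (h : R) (u : nat -> 'rV[R]_d)
    (t : R) : 'rV[R]_d :=
  let k := Num.truncn (t / h) in
  u k + (t / h - k%:R) *: (u k.+1 - u k).

Definition discrete_solution (R : realType) (d p : nat)
    (g : 'I_p -> R -> 'rV[R]_d -> R) (f : R -> 'rV[R]_d -> 'rV[R]_d)
    (T : R) (q0 : 'rV[R]_d) (n : nat) : R -> 'rV[R]_d :=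
  interpolate (T / n%:R) (scheme g f (T / n%:R) q0).

Definition Linfty_norm (R : realType) (d : nat) (T : R) (v : R -> 'rV[R]_d)
    : \bar R :=
  ('N[@lebesgue_measure R]_+oo
    [EFin \o ((fun t => enorm (v t)) \_ `[0%R, T])%R])%E.

(* Main.v *)
Require Import Defs.
From HB Require Import structures.
From mathcomp Require Import all_boot all_order all_algebra.
From mathcomp Require Import all_classical all_reals all_analysis.
From mathcomp Require Import measurable_realfun ess_sup_inf.
From mathcomp Require Import ring lra.

Set Implicit Arguments.
Unset Strict Implicit.
Unset Printing Implicit Defensive.

Import Order.TTheory GRing.Theory Num.Theory.
Import numFieldNormedType.Exports.

Local Open Scope classical_set_scope.
Local Open Scope ring_scope.

(** Why the error is of order h^(1/2). Write u_k for the values of the scheme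
    and measure the distance of its interpolation b to the solution q by the
    energy E = |b - q|^2. Both evolutions follow the perturbation f corrected
    by a normal vector: v = f(t, q) - q' is a proximal normal to Q(t) at q(t),
    and w = (u_k + h f - u_(k+1)) / h is normal to the convex set
    Qtilde(t_(k+1), u_k) at u_(k+1). If these sets were one and the same
    convex set, the two normal terms of E' would be nonpositive. What has to
    be shown is that non-convexity and motion only cost
        E' <= 2 C (E + h)   almost everywhere                [energy_rate],
    and then a Gronwall argument [gronwall_ac] on each mesh interval gives
    E + h <= exp(2 C T) h. The exponent 1/2 is the square root of this h; the
    remainder of order h^(1/2) coming from the time regularity of f fits, since
    |b - q| h^(1/2) <= E + h.

    The geometry rests on one construction. The inverse triangle inequality
    says that the convex hull of the normalized gradients of the almost active
    constraints stays away from 0; a nearly shortest vector of the hull then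
    increases all these constraints at a common rate
    [uniform_descent_direction]. Since each g_i(t, .) is convex, its tangent
    planes lie below it, so a move along this direction that repairs the
    linearized constraints repairs the constraints. This yields
    - the Lipschitz dependence of Q(t) on t [Q_lipschitz];
    - a quadratic approximation property: a point y of Q(t) is at distance
      O(|y - u|^2) from Qtilde(t, u), a subset of Q(t) [Qtilde_near].
    The second fact replaces normal cone calculus and multipliers: a vector
    normal to Qtilde(t, u) is, up to a quadratic error, normal to Q(t)
    [hypomonotone], and this applies to w by definition of the projection and
    to v because the proximal normals of Q(t) at x are normal to Qtilde(t, x)
    [prox_normal_Qtilde].

    The constants must not depend on n, so w and v have to be bounded: w by
    comparing the projection with a point of Qtilde close to u_k
    [scheme_step], and v by following the solution backwards in time, where
    the set cannot have receded faster than its Lipschitz constant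
    [normal_speed]. *)

(** * The Euclidean structure *)

Section euclid.
Context {R : realType} {d : nat}.
Implicit Types (u v w x y z : 'rV[R]_d) (a : R).

Lemma dotC u v : dot u v = dot v u.
Proof. by apply: eq_bigr => j _; rewrite mulrC. Qed.

Lemma dotDl u v w : dot (u + v) w = dot u w + dot v w.
Proof. by rewrite -big_split; apply: eq_bigr => j _; rewrite mxE mulrDl. Qed.

Lemma dotZl a u v : dot (a *: u) v = a * dot u v.
Proof. by rewrite mulr_sumr; apply: eq_bigr => j _; rewrite mxE mulrA. Qed.

Lemma dotDr u v w : dot w (u + v) = dot w u + dot w v.
Proof. by rewrite dotC dotDl !(dotC _ w). Qed.

Lemma dotZr a u v : dot v (a *: u) = a * dot v u.
Proof. by rewrite dotC dotZl dotC. Qed.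

Lemma dotNl u v : dot (- u) v = - dot u v.
Proof. by rewrite -scaleN1r dotZl mulN1r. Qed.

Lemma dotNr u v : dot v (- u) = - dot v u.
Proof. by rewrite dotC dotNl dotC. Qed.

Lemma dot0l v : dot 0 v = 0.
Proof. by rewrite -(scale0r v) dotZl mul0r. Qed.

Lemma dot0r v : dot v 0 = 0.
Proof. by rewrite dotC dot0l. Qed.

Definition dotE := (dotDl, dotDr, dotNl, dotNr, dotZl, dotZr, dot0l, dot0r).

Lemma dot_ge0 u : 0 <= dot u u.
Proof. by apply: sumr_ge0 => j _; rewrite -expr2 sqr_ge0. Qed.

Lemma enorm_ge0 u : 0 <= enorm u.
Proof. exact: sqrtr_ge0. Qed.
Hint Resolve enorm_ge0 : core.

Lemma enorm_sqr u : enorm u ^+ 2 = dot u u.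
Proof. by rewrite sqr_sqrtr// dot_ge0. Qed.

Lemma enorm0 : enorm (0 : 'rV[R]_d) = 0.
Proof. by rewrite /enorm dot0l sqrtr0. Qed.

Lemma enormZ a u : enorm (a *: u) = `|a| * enorm u.
Proof.
by rewrite /enorm !dotE mulrA -expr2 sqrtrM ?sqr_ge0// sqrtr_sqr.
Qed.

Lemma enormN u : enorm (- u) = enorm u.
Proof. by rewrite -scaleN1r enormZ normrN1 mul1r. Qed.

Lemma enormB u v : enorm (u - v) = enorm (v - u).
Proof. by rewrite -enormN opprB. Qed.

Lemma coord_le_enorm u j : `|u 0 j| <= enorm u.
Proof.
rewrite -(sqrtr_sqr (u 0 j)) ler_wsqrtr// /dot (bigD1 j)//= -expr2 lerDl.
by apply: sumr_ge0 => i _; rewrite -expr2 sqr_ge0.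
Qed.

Lemma enorm_eq0 u : enorm u = 0 -> u = 0.
Proof.
move=> u0; apply/rowP => j; rewrite mxE; apply/eqP; rewrite -normr_le0.
by rewrite -u0 coord_le_enorm.
Qed.

Lemma dot_le_enorm u v : dot u v <= enorm u * enorm v.
Proof.
have [v0|vN0] := eqVneq (enorm v) 0.
  by rewrite (enorm_eq0 v0) dot0r enorm0 mulr0.
have v_gt0 : 0 < enorm v by rewrite lt_def vN0 enorm_ge0.
have := dot_ge0 (enorm v ^+ 2 *: u - dot u v *: v).
rewrite !dotE (dotC v u) -!enorm_sqr.
set b := enorm v; set e := enorm u; set s := dot u v.
rewrite [X in 0 <= X](_ : _ = b ^+ 2 * ((e * b) ^+ 2 - s ^+ 2)); last by ring.
rewrite pmulr_rge0 ?exprn_gt0// subr_ge0.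
have [s0|s0] := lerP s 0; first by move=> _; rewrite (le_trans s0)// mulr_ge0 ?enorm_ge0.
by rewrite ler_sqr// nnegrE ?mulr_ge0 ?enorm_ge0// ltW.
Qed.

Lemma dot_norm_le u v : `|dot u v| <= enorm u * enorm v.
Proof.
rewrite ler_norml dot_le_enorm andbT lerNl -dotNl.
by rewrite -(enormN u) dot_le_enorm.
Qed.

Lemma enormD u v : enorm (u + v) <= enorm u + enorm v.
Proof.
rewrite -ler_sqr ?nnegrE ?addr_ge0 ?enorm_ge0// enorm_sqr !dotE (dotC v u).
rewrite -!enorm_sqr; have := dot_le_enorm u v; nra.
Qed.

Lemma enorm_chain y x z : enorm (x - z) <= enorm (x - y) + enorm (y - z).
Proof. by rewrite (le_trans _ (enormD _ _))// subrKA. Qed.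

(** Comparison with the max norm, which carries the topology. *)
Lemma mx_norm_le_enorm u : `|u| <= enorm u.
Proof.
rewrite [leLHS]mx_normrE; apply: bigmax_le => // -[i j] _ /=.
by rewrite (ord1 i) coord_le_enorm.
Qed.

Lemma enorm_le_mx_norm u : enorm u <= d%:R * `|u|.
Proof.
rewrite -ler_sqr ?nnegrE ?mulr_ge0 ?enorm_ge0// enorm_sqr.
have cu j : `|u 0 j| <= `|u|.
  rewrite [leRHS]mx_normrE.
  exact: (le_bigmax _ (fun ij : 'I_1 * 'I_d => `|u ij.1 ij.2|) (0, j)).
apply: (@le_trans _ _ (\sum_(j < d) `|u| ^+ 2)).
  apply: ler_sum => j _; rewrite -expr2 -real_normK ?num_real//.
  by rewrite lerXn2r// nnegrE.
rewrite sumr_const card_ord -[leLHS]mulr_natl exprMn.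
apply: ler_wpM2r; first exact: sqr_ge0.
by rewrite -natrX ler_nat; case: (d) => // k; rewrite expnS expn1 leq_pmulr.
Qed.

Lemma near_mx_norm_le x e : 0 < e -> \forall y \near x, `|x - y| <= e.
Proof. by move=> e0; apply/nbhs_normP; exists e => // y /= /ltW. Qed.

Lemma continuous_enorm : continuous (@enorm R d).
Proof.
move=> x; apply/(@cvgrPdist_le _ _ _ _ (nbhs_filter x)) => e e0.
have k0 : 0 < e / (d%:R + 1) by rewrite divr_gt0// ltr_wpDl.
apply: (filterS _ (near_mx_norm_le x k0)) => y xy.
have : enorm (x - y) <= e.
  apply: (le_trans (enorm_le_mx_norm _)).
  apply: (@le_trans _ _ ((d%:R + 1) * (e / (d%:R + 1)))); last first.
    by rewrite mulrCA mulfV ?mulr1// gt_eqF// ltr_wpDl.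
  by apply: ler_pM => //; rewrite lerDl.
have := enormD (x - y) y; have := enormD (y - x) x; rewrite !subrK (enormB y x).
by move=> ? ? ?; rewrite ler_norml; apply/andP; split; lra.
Qed.

Lemma continuous_dot v : continuous (dot v).
Proof.
move=> x; apply/(@cvgrPdist_le _ _ _ _ (nbhs_filter x)) => e e0.
have c0 : 0 < enorm v * d%:R + 1 by rewrite ltr_wpDl// mulr_ge0.
have k0 : 0 < e / (enorm v * d%:R + 1) by rewrite divr_gt0.
apply: (filterS _ (near_mx_norm_le x k0)) => y xy.
rewrite -dotNr -dotDr; apply: (le_trans (dot_norm_le _ _)).
apply: (@le_trans _ _ ((enorm v * d%:R + 1) * `|x - y|)).
  apply: (@le_trans _ _ (enorm v * (d%:R * `|x - y|))).
    by rewrite ler_wpM2l ?enorm_ge0// enorm_le_mx_norm.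
  by rewrite mulrA ler_wpM2r// lerDl.
by rewrite mulrC -ler_pdivlMr.
Qed.

(** Only the part of [S] no farther from [y] than a given point of [S] matters,
    and this part is compact. *)
Lemma projset_neq0 (S : set 'rV[R]_d) y :
  closed S -> S !=set0 -> projset S y !=set0.
Proof.
move=> cS [z0 Sz0].
pose K := S `&` [set z | enorm (y - z) <= enorm (y - z0)].
have cf : continuous (fun z => enorm (y - z)).
  move=> x; apply: (@continuous_comp _ _ _ (fun z => y - z) (@enorm R d)); last first.
    exact: continuous_enorm.
  by apply: continuousB; [exact: cst_continuous | move=> ?; exact].
have cK : compact K.
  apply: bounded_closed_compact.
    exists (enorm (y - z0) + enorm y); split; first exact: num_real.
    move=> M ltM z [_ /= zy]; apply: le_trans (ltW ltM).
    rewrite (le_trans (mx_norm_le_enorm _))//.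
    have -> : z = (z - y) + y by rewrite subrK.
    by rewrite (le_trans (enormD _ _))// lerD2r (enormB z).
  apply: closedI => //.
  apply: (@preimage_closed _ _ (fun z => enorm (y - z)) [set r | r <= enorm (y - z0)]).
    by move=> z _; exact: cf.
  exact: closed_le.
have [z] := @EVT_min_rV _ _ (fun z => enorm (y - z)) K
  (ex_intro _ z0 (conj Sz0 (lexx _))) cK (continuous_subspaceT cf).
rewrite inE => -[Sz zz0] zmin; exists z; split=> //.
apply/eqP; rewrite eq_le; apply/andP; split.
  apply: lb_le_inf; first by exists (enorm (y - z)), z.
  move=> _ [x Sx <-]; have [xz0|xz0] := leP (enorm (y - x)) (enorm (y - z0)).
    by apply: zmin; rewrite inE.
  exact: le_trans zz0 (ltW xz0).
apply: ge_inf; last by exists z.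
by exists 0 => _ [x _ <-]; exact: enorm_ge0.
Qed.

(** Perturbing a foot point [z] of [y] along [v] and letting the perturbation
    tend to zero leaves the first-order term. *)
Lemma projset_variation (S : set 'rV[R]_d) y z v :
  projset S y z -> (forall e : R, 0 < e <= 1 -> S (z + e *: v)) ->
  dot (y - z) v <= 0.
Proof.
move=> [Sz yz] Sv; rewrite leNgt; apply/negP => lt0.
have key e : 0 < e <= 1 -> 2 * dot (y - z) v <= e * dot v v.
  move=> /[dup] e01 /andP[e0 e1].
  have : enorm (y - z) <= enorm (y - (z + e *: v)).
    rewrite yz; apply: ge_inf; last by exists (z + e *: v) => //; exact: Sv.
    by exists 0 => _ [x _ <-]; exact: enorm_ge0.
  rewrite -ler_sqr ?nnegrE ?enorm_ge0// !enorm_sqr opprD addrA.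
  move: (y - z) => w.
  rewrite !dotE (dotC v w) => H.
  rewrite -(ler_pM2l e0); nra.
have vv := dot_ge0 v.
pose e := Num.min 1 (dot (y - z) v / (dot v v + 1)).
have e01 : 0 < e <= 1.
  rewrite ge_min lexx andbT lt_min ltr01/= divr_gt0//; lra.
have := key e e01.
have : e * (dot v v + 1) <= dot (y - z) v.
  by rewrite -ler_pdivlMr ?ge_min ?lexx ?orbT//; lra.
move/andP : e01 => [e0 e1]; nra.
Qed.

Lemma projset_prox (S : set 'rV[R]_d) y z :
  projset S y z -> forall x, S x -> enorm (y - z) <= enorm (y - x).
Proof.
move=> [Sz ->] x Sx; apply: ge_inf; last by exists x.
by exists 0 => _ [w _ <-]; exact: enorm_ge0.
Qed.

End euclid.
#[global] Hint Resolve enorm_ge0 : core.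

(** * Induction on an interval, and monotonicity of absolutely continuous functions *)

(** A property that passes across every short interval containing a given point
    reaches the right end: the supremum of the points reached could otherwise be
    passed. Gauge partitions are thus used without being constructed. *)
Lemma cousin_induction (R : realType) (a b : R) (P : R -> Prop) :
  a <= b -> P a ->
  (forall t, a <= t <= b -> exists2 r : R, 0 < r &
     forall x y, a <= x -> y <= b -> t - r < x -> x <= t -> t <= y -> y < t + r ->
       P x -> P y) ->
  P b.
Proof.
move=> ab Pa step.
pose S := [set x | [/\ a <= x, x <= b & P x]].
have Sa : S a by split.
have supS : has_sup S by split; [exists a | exists b => x []].
have aS : a <= sup S by apply: sup_upper_bound.
have Sb : sup S <= b by apply: sup_le_ub; [exists a | move=> x []].
have [r r0 stepS] := step (sup S) (introT andP (conj aS Sb)).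
have [x [ax xb Px] xS] := sup_adherent r0 supS.
have xleS : x <= sup S by apply: sup_upper_bound.
have [bS|Slt] := leP b (sup S).
  apply: (stepS x b) => //; lra.
have minle : sup S < Num.min b (sup S + r / 2) by rewrite lt_min Slt/=; lra.
have : S (Num.min b (sup S + r / 2)).
  split; first exact: le_trans aS (ltW minle).
    by rewrite ge_min lexx.
  apply: (stepS x) => //; first by rewrite ge_min lexx.
    exact: ltW.
  by rewrite gt_min; apply/orP; right; lra.
by move=> /(sup_upper_bound supS); rewrite leNgt minle.
Qed.

(** A null set is contained in an open set [V] of measure less than [dl]. Taking
    for [phi x] the measure of the part of [V] to the left of [x], the total length
    of non-overlapping intervals placed around points of the null set is controlled
    by the increment of [phi], hence by [dl]. *)
Lemma negligible_gauge (R : realType) (N : set R) (dl : R) :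
  (@lebesgue_measure R).-negligible N -> 0 < dl ->
  exists2 phi : R -> R, (forall x, 0 <= phi x < dl) &
    (forall x y, x <= y -> phi x <= phi y) /\
    forall t, N t -> exists2 r : R, 0 < r &
      forall x y, t - r < x -> x <= y -> y < t + r -> y - x <= phi y - phi x.
Proof.
move=> [A [mA A0 NA]] dl0.
have muA : (lebesgue_measure A < +oo)%E by rewrite [ltLHS]A0.
have [V [oV AV VA]] := lebesgue_regularity_outer mA muA dl0.
have mV : measurable V by exact: open_measurable.
have muV : (lebesgue_measure V < dl%:E)%E.
  have /(congr1 lebesgue_measure) : V = (V `\` A) `|` A by rewrite setDKU.
  move=> ->; apply: le_lt_trans VA.
  apply: (le_trans (measureU2 _ _ _)) => //; first exact: measurableD.
  by rewrite [X in (_ + X)%E]A0 adde0.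
pose W x := V `&` `]-oo, x[.
have mW x : measurable (W x) by exact: measurableI.
have Wlt x : (lebesgue_measure (W x) < dl%:E)%E.
  apply: le_lt_trans muV; apply: le_measure; rewrite ?inE//=.
  - exact: mW.
  - exact: subIsetl.
have Wfin x : lebesgue_measure (W x) \is a fin_num.
  by rewrite ge0_fin_numE// (lt_trans (Wlt x))// ltry.
exists (fun x => fine (lebesgue_measure (W x))).
  by move=> x; apply/andP; split; [exact: fine_ge0|rewrite -lte_fin fineK].
split.
  move=> x y xy; apply: fine_le => //; apply: le_measure; rewrite ?inE; try exact: mW.
  by apply: setIS => z /=; rewrite !in_itv/= => /lt_le_trans; apply.
move=> t /NA/AV Vt; have := open_nbhs_nbhs (conj oV Vt).
move=> /nbhs_ballP[r /= r0 rV]; exists r => // x y rx xy yr.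
rewrite lerBrDr -lee_fin EFinD !fineK//.
have -> : W y = `[x, y[%classic `|` W x.
  apply/seteqP; split => z /=; rewrite /W/= !in_itv/=.
    by move=> [Vz zy]; case: (ltP z x) => xz; [right|left].
  move=> [/andP[xz zy]|[Vz zx]]; last by split => //; exact: lt_le_trans zx xy.
  split=> //; apply: rV; rewrite /ball/= ltr_norml; apply/andP; split; lra.
rewrite measureU//; [|exact: mW|]; last first.
  apply/seteqP; split => // z /=; rewrite /W/= !in_itv/= => -[/andP[xz _] [_]].
  by rewrite ltNge xz.
apply: leeD2r.
rewrite [leRHS](_ : _ = lebesgue_measure `[x, y[%classic)//.
rewrite lebesgue_measure_itv/= lte_fin; case: ltP => // yx.
by rewrite lee_fin; lra.
Qed.

(** Absolute continuity, with the non-overlapping intervals listed from left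
    to right so that families can grow by one interval at the right end. *)
Definition ac_on (R : realType) (a b : R) (F : R -> R) : Prop :=
  forall e : R, 0 < e -> exists2 dl : R, 0 < dl &
    forall s : seq (R * R), pairwise (fun p q => p.2 <= q.1) s ->
      (forall p, p \in s -> [/\ a <= p.1, p.1 <= p.2 & p.2 <= b]) ->
      \sum_(p <- s) (p.2 - p.1) < dl -> \sum_(p <- s) `|F p.2 - F p.1| < e.

(** Cut [a, b] into intervals around points. Around a point where the derivative is
    at most 0, the increase of [F] over a short interval is at most a small
    multiple of its length; the other intervals have small total length by
    [negligible_gauge], so that absolute continuity bounds the increase over them.
    The proposition carried along the induction records the second family. *)
Lemma ac_on_le (R : realType) (a b : R) (F : R -> R) :
  a <= b -> ac_on a b F ->
  {ae @lebesgue_measure R, forall t, a <= t <= b ->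
     exists2 l : R, is_derive t 1 F l & l <= 0} ->
  F b <= F a.
Proof.
move=> ab acF [N [mN N0 dF]].
apply/ler_addgt0Pr => e e0.
(* the share [e' * (b - a)] goes to the good intervals and [e'] to the bad ones *)
have ba1 : 0 < b - a + 1 by lra.
pose e' := e / (b - a + 1).
have e'0 : 0 < e' by rewrite divr_gt0.
have [dl dl0 acdl] := acF _ e'0.
have [phi phi01 [phi_mono phiN]] := negligible_gauge (ex_intro _ N (And3 mN N0 (@subset_refl _ _))) dl0.
pose P x := exists s : seq (R * R), [/\ pairwise (fun p q => p.2 <= q.1) s,
  (forall p, p \in s -> [/\ a <= p.1, p.1 <= p.2 & p.2 <= x]),
  \sum_(p <- s) (p.2 - p.1) <= phi x - phi a &
  F x - F a <= e' * (x - a) + \sum_(p <- s) `|F p.2 - F p.1|].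
suff [s [ps sab slen sF]] : P b.
  have := acdl s ps sab.
  have /andP[_ phib] := phi01 b; have /andP[phia _] := phi01 a.
  have -> : e = e' * (b - a + 1) by rewrite divfK// gt_eqF.
  have : \sum_(p <- s) (p.2 - p.1) < dl by lra.
  move=> -> /(_ isT); lra.
apply: (cousin_induction ab).
  by exists [::]; split => //; rewrite !big_nil ?subrr ?mulr0 ?addr0.
move=> t tab; have [/phiN[r r0 phir]|Nt] := pselect (N t).
  exists r => // x y ax yb rx xt ty yr [s [ps sax slen sF]].
  have xy := le_trans xt ty.
  exists (rcons s (x, y)); split.
  - rewrite -cats1 pairwise_cat ps/= andbT; apply/allrelP => p q ps'.
    by rewrite inE => /eqP -> /=; have [] := sax p ps'.
  - move=> p; rewrite mem_rcons inE => /orP[/eqP -> //|/sax[? ? ?]].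
    by split=> //; lra.
  - rewrite big_rcons/=; have := phir x y rx xy yr; lra.
  - rewrite big_rcons/=; have := ler_norm (F y - F x); nra.
have [l dFl l0] : exists2 l : R, is_derive t 1 F l & l <= 0.
  by apply: contrapT => nd; apply: Nt; apply: dF => /= /(_ tab).
have [r r0 rF] : exists2 r : R, 0 < r & forall z, `|z - t| < r ->
    `|F z - F t - l * (z - t)| <= e' * `|z - t|.
  have [dFt lE] := dFl; move: dFt => /cvgrPdist_le/(_ _ e'0); rewrite -[lim _]/('D_1 F t) lE.
  move=> [r /= r0 rF]; exists r => // z zr.
  have [->|zt] := eqVneq z t; first by rewrite !subrr mulr0 subr0 normr0 mulr0.
  have zt0 : z - t != 0 by rewrite subr_eq0.
  have := rF (z - t); rewrite /ball_/= sub0r normrN => /(_ zr zt0).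
  rewrite /= [_%:A]mulr1 subrK => H.
  rewrite [X in `|X|](_ : _ = ((z - t)^-1 * (F z - F t) - l) * (z - t)); last by field.
  by rewrite normrM ler_wpM2r// distrC.
exists r => // x y ax yb rx xt ty yr [s [ps sax slen sF]].
exists s; split => //.
- by move=> p /sax[? ? ?]; split => //; lra.
- have := phi_mono x y (le_trans xt ty); lra.
have := rF y; rewrite ger0_norm; last lra.
have := rF x; rewrite (distrC x t) [`|t - x|]ger0_norm; last lra.
move=> H1 H2.
have := H1 ltac:(lra); have := H2 ltac:(lra).
rewrite !ler_norml => /andP[_ h2] /andP[h1 _].
nra.
Qed.

(** * Gronwall inequality along absolutely continuous curves *)

Lemma is_derive_dot_diag (R : realType) (d : nat) (w : R -> 'rV[R]_d) (t : R) :
  derivable w t 1 ->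
  is_derive t 1 (fun s => dot (w s) (w s)) (2 * dot (w t) ('D_1 w t)).
Proof.
move=> dw.
have dwj j : is_derive t 1 (fun s => w s 0 j) ('D_1 w t 0 j).
  rewrite derive_mx// mxE; apply: derivableP.
  by move/derivable_mxP : dw; apply.
have -> : (fun s => dot (w s) (w s)) = \sum_(j < d) ((fun s => w s 0 j) * (fun s => w s 0 j)).
  by apply/funext => s; rewrite fct_sumE.
apply: is_derive_eq.
rewrite mulr_sumr; apply: eq_bigr => j _.
set D := 'D_1 w t 0 j; change (w t 0 j * D + w t 0 j * D = 2 * (w t 0 j * D)).
by ring.
Qed.

Section absolutely_continuous_curve.
Context (R : realType) (d : nat) (T : R) (q : R -> 'rV[R]_d).
Hypothesis q_ac : abs_continuous T q.

Lemma abs_continuous_uniform (e : R) : 0 < e -> exists2 dl : R, 0 < dl &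
  forall s t : R, 0 <= s -> s <= t -> t <= T -> t - s < dl ->
    enorm (q t - q s) < e.
Proof.
move=> e0; have [dl dl0 qdl] := q_ac e0; exists dl => // s t s0 st tT ts.
have := qdl 1%N (fun=> s) (fun=> t); rewrite !big_ord1; apply => //.
by move=> j k; rewrite !ord1.
Qed.

(** Absolute continuity bounds the increment of [q] by 1 over intervals of a fixed
    length, and finitely many of them cover [0, T]. *)
Lemma abs_continuous_bounded : 0 <= T -> exists2 B : R, 0 < B &
  forall t, 0 <= t <= T -> enorm (q t) <= B.
Proof.
move=> T0; have [dl dl0 qdl] := abs_continuous_uniform ltr01.
pose P x := exists2 B : R, 0 < B & forall t, 0 <= t <= x -> enorm (q t) <= B.
apply: (cousin_induction (P := P) T0).
  exists (enorm (q 0) + 1); first by rewrite ltr_wpDl// enorm_ge0.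
  by move=> t; rewrite -eq_le => /eqP <-; rewrite lerDl.
move=> t tT; exists (dl / 2); first by rewrite divr_gt0.
move=> x y x0 yT tx xt ty yt [B B0 qB]; exists (B + 1); first by rewrite ltr_wpDr.
move=> s /andP[s0 sy]; have [sx|xs] := leP s x.
  by have := qB s; rewrite s0 sx => /(_ isT); lra.
have := qdl x s x0 (ltW xs) (le_trans sy yT) ltac:(lra).
have := enormD (q s - q x) (q x); rewrite subrK.
have := qB x; rewrite x0 lexx => /(_ isT); lra.
Qed.

(** Absolute continuity of the solution passes to every scalar quantity whose
    increments are dominated by those of the solution and of time. *)
Lemma abs_continuous_ac_on (a b K : R) (F : R -> R) :
  0 <= a -> b <= T -> 0 <= K ->
  (forall x y, a <= x -> x <= y -> y <= b ->
     `|F y - F x| <= K * (y - x + enorm (q y - q x))) ->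
  ac_on a b F.
Proof.
move=> a0 bT K0 FK e e0.
have K1 : 0 < 2 * (K + 1) by lra.
have e'0 : 0 < e / (2 * (K + 1)) by rewrite divr_gt0.
have [dl dl0 qdl] := q_ac e'0.
exists (Num.min dl (e / (2 * (K + 1)))); first by rewrite lt_min dl0.
move=> s ps sab; rewrite lt_min => /andP[sdl se].
pose A (j : 'I_(size s)) := (nth (0, 0) s j).1.
pose B (j : 'I_(size s)) := (nth (0, 0) s j).2.
have sAB j : [/\ a <= A j, A j <= B j & B j <= b] by apply: sab; exact: mem_nth.
have sumE (f : R * R -> R) : \sum_(p <- s) f p = \sum_(j < size s) f (A j, B j).
  rewrite (big_nth (0, 0)) big_mkord; apply: eq_bigr => j _.
  by congr f; rewrite [LHS]surjective_pairing.
have sq : \sum_(p <- s) enorm (q p.2 - q p.1) < e / (2 * (K + 1)).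
  rewrite (sumE (fun p => enorm (q p.2 - q p.1))).
  apply: (qdl (size s) A B).
  - move=> j; have [? ? ?] := sAB j.
    by split=> //; [exact: le_trans a0 _|exact: le_trans bT].
  - move=> j k jk; move/(pairwiseP (0, 0)) : ps => ps.
    have [jk'|kj|/val_inj jk'] := ltngtP j k.
    + by left; apply: ps => //; rewrite inE.
    + by right; apply: ps => //; rewrite inE.
    + by rewrite jk' eqxx in jk.
  - by rewrite -(sumE (fun p => p.2 - p.1)).
have : \sum_(p <- s) `|F p.2 - F p.1| <=
    K * (\sum_(p <- s) (p.2 - p.1) + \sum_(p <- s) enorm (q p.2 - q p.1)).
  rewrite -big_split mulr_sumr big_seq [leRHS]big_seq.
  by apply: ler_sum => p /sab[? ? ?]; exact: FK.
move=> H; apply: (le_lt_trans H).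
set S1 := \sum_(p <- s) _ in se *; set S2 := \sum_(p <- s) _ in sq *.
have : (S1 + S2) < e / (K + 1).
  rewrite (_ : e / (K + 1) = e / (2 * (K + 1)) + e / (2 * (K + 1))); first exact: ltrD.
  by field; rewrite gt_eqF//; lra.
move=> H2; apply: (@le_lt_trans _ _ (K * (e / (K + 1)))).
  by rewrite ler_wpM2l// ltW.
by rewrite mulrA ltr_pdivrMr; [nra|lra].
Qed.

End absolutely_continuous_curve.

Lemma expR_lipschitz (R : realType) (C x y : R) : 0 <= C -> 0 <= x -> x <= y ->
  `|expR (- C * y) - expR (- C * x)| <= C * (y - x).
Proof.
move=> C0 x0 xy.
have Cx : 0 <= C * x by rewrite mulr_ge0.
have Cxy : C * x <= C * y by rewrite ler_wpM2l.
have e1 : expR (- C * x) <= 1 by rewrite -expR0 ler_expR; lra.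
have eyx : expR (- C * y) = expR (- C * x) * expR (- (C * (y - x))).
  by rewrite -expRD; congr expR; ring.
have e2 : expR (- (C * (y - x))) <= 1 by rewrite -expR0 ler_expR; lra.
have e3 := expR_ge1Dx (- (C * (y - x))).
have e0 := expR_gt0 (- C * x).
rewrite eyx; set e := expR (- C * x) in e0 e1 *.
rewrite distrC ger0_norm; nra.
Qed.

Lemma is_derive_expRM (R : realType) (k t : R) :
  is_derive t 1 (fun s : R => expR (k * s)) (k * expR (k * t)).
Proof.
have dl : is_derive t 1 (k \*: (@id R)) k.
  by apply: is_derive_eq; rewrite [_%:A]mulr1.
rewrite mulrC; exact: (is_derive1_comp (is_derive_expR (k * t)) dl).
Qed.

(** [w] need not be controlled by [q] itself, only its increments by those of [q]:
    this makes [exp (- 2 C t) (|w|^2 + h)] absolutely continuous, and the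
    differential inequality makes its derivative nonpositive. *)
Lemma gronwall_ac (R : realType) (d : nat) (T a b C S h : R)
    (q w : R -> 'rV[R]_d) :
  abs_continuous T q -> 0 <= a -> a <= b -> b <= T -> 0 <= C -> 0 <= S -> 0 <= h ->
  (forall x y, a <= x -> x <= y -> y <= b ->
     enorm (w y - w x) <= S * (y - x) + enorm (q y - q x)) ->
  {ae @lebesgue_measure R, forall t, a <= t <= b -> derivable w t 1 /\
     dot (w t) ('D_1 w t) <= C * (dot (w t) (w t) + h)} ->
  dot (w b) (w b) + h <= expR (2 * C * (b - a)) * (dot (w a) (w a) + h).
Proof.
move=> qac a0 ab bT C0 S0 h_ge0 wq dw.
have [B B0 qB] := abs_continuous_bounded qac (le_trans a0 (le_trans ab bT)).
pose Wb := enorm (w a) + S * (b - a) + 2 * B.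
have wB x : a <= x -> x <= b -> enorm (w x) <= Wb.
  move=> ax xb; have := wq a x (lexx _) ax xb.
  have := enormD (w x - w a) (w a); rewrite subrK.
  have := enormD (q x) (- q a); rewrite enormN.
  have := qB x; rewrite (le_trans a0 ax) (le_trans xb bT) => /(_ isT).
  have := qB a; rewrite a0 (le_trans ab bT) => /(_ isT).
  have : S * (x - a) <= S * (b - a) by rewrite ler_wpM2l//; lra.
  rewrite /Wb; lra.
have Wb0 : 0 <= Wb by exact: le_trans (enorm_ge0 _) (wB a (lexx _) ab).
pose E t := dot (w t) (w t).
pose F t := expR (- (2 * C) * t) * (E t + h).
have C20 : 0 <= 2 * C by rewrite mulr_ge0.
have EB x : a <= x -> x <= b -> 0 <= E x <= Wb ^+ 2.
  move=> ax xb; apply/andP; split; first exact: dot_ge0.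
  by rewrite /E -enorm_sqr lerXn2r// ?nnegrE ?enorm_ge0// wB.
pose K := 2 * Wb * (S + 1) + 2 * C * (Wb ^+ 2 + h).
have acF : ac_on a b F.
  apply: (abs_continuous_ac_on qac (K := K)) => //.
    rewrite addr_ge0// !mulr_ge0// ?addr_ge0// ?sqr_ge0//.
  move=> x y ax xy yb.
  have x0 := le_trans a0 ax; have xb := le_trans xy yb; have ay := le_trans ax xy.
  have -> : F y - F x = expR (- (2 * C) * y) * (E y - E x) +
      (expR (- (2 * C) * y) - expR (- (2 * C) * x)) * (E x + h).
    by rewrite /F; ring.
  have dexp := expR_lipschitz C20 x0 xy.
  have /andP[E0 EW] := EB x ax xb.
  have ey1 : expR (- (2 * C) * y) <= 1.
    rewrite -[leRHS]expR0 ler_expR mulNr oppr_le0; apply: mulr_ge0 => //.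
    exact: le_trans xy.
  have qyx := enorm_ge0 (q y - q x).
  have dE : `|E y - E x| <= 2 * Wb * (S * (y - x) + enorm (q y - q x)).
    have -> : E y - E x = dot (w y - w x) (w y + w x).
      by rewrite /E !dotE (dotC (w x) (w y)); ring.
    rewrite (le_trans (dot_norm_le _ _))// mulrC ler_pM ?enorm_ge0//; last exact: wq.
    rewrite (le_trans (enormD _ _))//.
    by have := wB x ax xb; have := wB y ay yb; lra.
  rewrite (le_trans (ler_normD _ _))// !normrM (ger0_norm (ltW (expR_gt0 _))).
  rewrite (ger0_norm (addr_ge0 E0 h_ge0)).
  have t1 : expR (- (2 * C) * y) * `|E y - E x| <=
      2 * Wb * (S * (y - x) + enorm (q y - q x)).
    by apply: le_trans dE; rewrite ler_piMl.
  have t2 : `|expR (- (2 * C) * y) - expR (- (2 * C) * x)| * (E x + h) <=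
      2 * C * (y - x) * (Wb ^+ 2 + h).
    by rewrite ler_pM ?addr_ge0// lerD2r.
  have yx : 0 <= y - x by rewrite subr_ge0.
  have t3 : 0 <= 2 * Wb * (y - x) by rewrite !mulr_ge0.
  have t4 : 0 <= 2 * Wb * S * enorm (q y - q x) by rewrite !mulr_ge0.
  have t5 : 0 <= 2 * C * (Wb ^+ 2 + h) * enorm (q y - q x).
    by rewrite !mulr_ge0// addr_ge0// sqr_ge0.
  rewrite /K; lra.
have Fab : F b <= F a.
  apply: (ac_on_le ab acF); apply: negligibleS dw => t; apply: contra_not => H tab.
  have [dwt Ht] := H tab.
  have dE := is_derive_dot_diag dwt.
  exists (expR (- (2 * C) * t) * (2 * dot (w t) ('D_1 w t)) +
      (E t + h) * (- (2 * C) * expR (- (2 * C) * t))); last first.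
    have e0 := expR_gt0 (- (2 * C) * t).
    rewrite -/(E t) in Ht.
    rewrite [X in X <= 0](_ : _ = expR (- (2 * C) * t) * (2 *
      (dot (w t) ('D_1 w t) - C * (E t + h)))); last by ring.
    by rewrite pmulr_rle0//; lra.
  have dEh : is_derive t 1 (E + cst h) (2 * dot (w t) ('D_1 w t)).
    by apply: is_derive_eq; rewrite addr0.
  exact: (is_deriveM (is_derive_expRM (- (2 * C)) t) dEh).
have e0 := expR_gt0 (- (2 * C) * b).
rewrite -(ler_pM2l e0) -/(E b) -/(E a) mulrA -expRD.
by rewrite (_ : - (2 * C) * b + 2 * C * (b - a) = - (2 * C) * a); [|ring].
Qed.

(** The interpolation between two nodes, as an affine function of time. *)
Lemma is_derive_affine (R : realType) (d : nat) (a v : 'rV[R]_d) (h k t : R) :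
  is_derive t 1 (fun s : R => a + (s / h - k) *: v) (h^-1 *: v).
Proof.
have lim : (fun e : R => e^-1 *: ((a + ((e *: 1 + t) / h - k) *: v) -
    (a + (t / h - k) *: v))) @ 0^' --> h^-1 *: v.
  apply: cvg_near_cst; near=> e.
  have e0 : e != 0 by near: e; exact: nbhs_dnbhs_neq.
  rewrite [_%:A]mulr1 opprD addrACA subrr add0r -scalerBl scalerA.
  by congr (_ *: _); rewrite opprB addrA subrK -mulrBl addrK mulrA mulVf ?mul1r.
by apply: DeriveDef; [apply/cvg_ex; eexists; exact: lim | exact: cvg_lim lim].
Unshelve. all: by end_near. Qed.

(** * Convexity and mean value inequalities *)

Section calculus.
Context {R : realType} {d : nat}.
Implicit Types (h : 'rV[R]_d -> R) (u v x y z : 'rV[R]_d).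

Lemma derivable_quotient (V W : normedModType R) (f : V -> W) (x v : V) (e : R) :
  derivable f x v -> 0 < e ->
  exists2 r : R, 0 < r & forall s : R, s != 0 -> `|s| < r ->
    `|'D_v f x - s^-1 *: (f (s *: v + x) - f x)| < e.
Proof.
move=> /cvgrPdist_lt/[apply] -[r /= r0 rP]; exists r => // s s0 sr.
by apply: rP => //=; rewrite sub0r normrN.
Qed.

Lemma derivable_quotientR (V : normedModType R) (f : V -> R) (x v : V) (e : R) :
  derivable f x v -> 0 < e ->
  exists2 r : R, 0 < r & forall s : R, s != 0 -> `|s| < r ->
    `|'D_v f x - s^-1 * (f (s *: v + x) - f x)| < e.
Proof. by move=> df e0; exact: derivable_quotient. Qed.

(** The gradient is defined by partial derivatives; this links it with directional
    ones. *)
Lemma derive_grad h x v :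
  differentiable (h : 'rV[R]_d -> R^o) x -> 'D_v h x = dot (grad h x) v.
Proof.
move=> dh; rewrite deriveE// {1}(row_sum_delta v) linear_sum.
apply: eq_bigr => j _; rewrite linearZ/= mxE deriveE// mulrC; congr (_ * _).
Qed.

(** The difference quotients of [h] at [x] along [y - x] are at most [h y - h x] for
    steps in (0, 1]. *)
Lemma convex_ge_tangent h x y :
  convex_function [set: 'rV[R]_d] h ->
  differentiable (h : 'rV[R]_d -> R^o) x ->
  h x + dot (grad h x) (y - x) <= h y.
Proof.
move=> ch dh; rewrite -derive_grad// leNgt; apply/negP => lt0.
have gap : 0 < h x + 'D_(y - x) h x - h y by lra.
have dhv : derivable h x (y - x) by exact: diff_derivable dh.
have [r r0 rP] := derivable_quotientR dhv gap.
pose s := Num.min 1 (r / 2).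
have s0 : 0 < s by rewrite lt_min ltr01/= divr_gt0.
have s1 : s <= 1 by rewrite ge_min lexx.
have sr : `|s| < r by rewrite gtr0_norm// gt_min; apply/orP; right; lra.
have /andP[/= s0' s1'] : (0 <= s) && (s <= 1) by rewrite ltW.
have := rP s (lt0r_neq0 s0) sr.
have := ch (Itv01 s0' s1') y x.
rewrite !inE => /(_ I I).
rewrite convRE /conv/= /unstable.onem.
have -> : s *: y + (1 - s) *: x = s *: (y - x) + x.
  by rewrite scalerBl scale1r scalerBr addrA addrAC.
set k := h (_ + x) => Hk.
move=> /ltr_normlP[_ lt1].
suff : s^-1 * (k - h x) <= h y - h x by lra.
by rewrite ler_pdivrMl//; lra.
Qed.

Lemma enorm_sum (I : Type) (r : seq I) (P : pred I) (F : I -> 'rV[R]_d) :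
  enorm (\sum_(i <- r | P i) F i) <= \sum_(i <- r | P i) enorm (F i).
Proof.
elim/big_rec2: _ => [|i s w _ H]; first by rewrite enorm0.
by rewrite (le_trans (enormD _ _))// lerD2l.
Qed.

Lemma enorm_mulmx_le (A : 'M[R]_d) v : enorm (v *m A) <= opnorm A * enorm v.
Proof.
have bnd u : enorm u <= 1 -> enorm (u *m A) <= \sum_j enorm (row j A).
  move=> u1; rewrite mulmx_sum_row (le_trans (enorm_sum _ _ _))//.
  apply: ler_sum => j _; rewrite enormZ ler_piMl//.
    exact: enorm_ge0.
  exact: le_trans (coord_le_enorm u j) u1.
have [v0|vN0] := eqVneq (enorm v) 0.
  by rewrite (enorm_eq0 v0) mul0mx enorm0 mulr0.
have v_gt0 : 0 < enorm v by rewrite lt_def vN0 enorm_ge0.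
rewrite -ler_pdivrMr//; apply: sup_upper_bound.
  split; first by exists (enorm (0 *m A)), 0 => //=; rewrite enorm0.
  by exists (\sum_j enorm (row j A)) => _ [u u1 <-]; exact: bnd.
exists ((enorm v)^-1 *: v) => /=.
  by rewrite enormZ gtr0_norm ?invr_gt0// mulVf.
by rewrite -scalemxAl enormZ gtr0_norm ?invr_gt0// mulrC.
Qed.

(** Scalar products with a fixed [u] turn the vector-valued [F] into a function to
    which the mean value theorem applies. *)
Lemma is_derive_dot_line (F : 'rV[R]_d -> 'rV[R]_d) u x v (s : R) :
  derivable F (x + s *: v) v ->
  is_derive s 1 (fun s : R => dot u (F (x + s *: v)))
    (dot u ('D_v F (x + s *: v))).
Proof.
move=> dF.
have lim : (fun e : R => e^-1 *: (dot u (F (x + (e *: 1 + s) *: v)) -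
    dot u (F (x + s *: v)))) @ 0^' --> dot u ('D_v F (x + s *: v)).
  apply: (@cvg_trans _ ((dot u \o (fun e : R => e^-1 *:
      (F (e *: v + (x + s *: v)) - F (x + s *: v)))) @ 0^')).
    apply: near_eq_cvg; near=> e => /=.
    rewrite [_%:A]mulr1 dotZr dotDr dotNr; congr (_ * (dot u (F _) - _)).
    by rewrite scalerDl addrCA.
  by apply: (continuous_cvg _ _ dF); exact: continuous_dot.
by apply: DeriveDef; [apply/cvg_ex; eexists; exact: lim | exact: cvg_lim lim].
Unshelve. all: by end_near. Qed.

(** The mean value theorem is applied to the component of the gradient along its
    own total increment, because it fails for vector-valued functions. *)
Lemma grad_lipschitz h x y (M : R) :
  (forall s : R, 0 <= s <= 1 -> differentiable (grad h) (x + s *: (y - x)) /\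
     opnorm (hess h (x + s *: (y - x))) <= M) ->
  enorm (grad h y - grad h x) <= M * enorm (y - x).
Proof.
move=> hM; set D := grad h y - grad h x; set v := y - x.
have dphi (s : R) : 0 <= s <= 1 ->
    is_derive s 1 (fun s : R => dot D (grad h (x + s *: v)))
      (dot D ('D_v (grad h) (x + s *: v))).
  move=> /hM[dg _]; apply: is_derive_dot_line; exact: diff_derivable.
have [||s /= s01] := @MVT_segment R (fun s : R => dot D (grad h (x + s *: v)))
    (fun s : R => dot D ('D_v (grad h) (x + s *: v))) 0 1 ler01.
- move=> s; rewrite in_itv/= => /andP[s0 s1]; apply: dphi; apply/andP; split; lra.
- apply: derivable_within_continuous => s; rewrite in_itv/= => s01.
  by apply: ex_derive; exact: dphi.
have xv : x + v = y by rewrite /v addrC subrK.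
rewrite scale1r scale0r addr0 xv subr0 mulr1 -dotNr -dotDr -/D => DD.
move: s01; rewrite in_itv/= => /hM[dg hs].
have : enorm D ^+ 2 <= enorm D * (M * enorm v).
  rewrite enorm_sqr DD (le_trans (dot_le_enorm _ _))// ler_wpM2l ?enorm_ge0//.
  rewrite deriveEjacobian// (le_trans (enorm_mulmx_le _ _))//.
  by apply: ler_wpM2r; [exact: enorm_ge0|exact: hs].
have [->|DN0] := eqVneq (enorm D) 0.
  have : 0 <= opnorm (hess h (x + s *: v)) * enorm v.
    by apply: le_trans (enorm_mulmx_le _ _); exact: enorm_ge0.
  by move=> H _; apply: (le_trans H); apply: ler_wpM2r; [exact: enorm_ge0|exact: hs].
by rewrite expr2 ler_pM2l// lt_def DN0 enorm_ge0.
Qed.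

End calculus.

(** [is_tderive] is one-sided at the end points and neglects values outside
    [0, T]; induction on the interval uses it as it is, where the mean value theorem
    would first need continuity and two-sided derivatives. *)
Lemma tderive_lipschitz (R : realType) (T beta : R) (phi : R -> R) :
  (forall t, t \in `[0, T] ->
     exists2 l : R, is_tderive T (phi : R -> R^o) t l & `|l| <= beta) ->
  forall s t, s \in `[0, T] -> t \in `[0, T] ->
    `|phi t - phi s| <= beta * `|t - s|.
Proof.
move=> dphi.
suff H s t : 0 <= s -> s <= t -> t <= T -> `|phi t - phi s| <= beta * (t - s).
  move=> s t; rewrite !in_itv/= => /andP[s0 sT] /andP[t0 tT].
  have [st|ts] := leP s t; first by rewrite [`|t - s|]ger0_norm ?subr_ge0// H.
  by rewrite distrC [`|t - s|]distrC [`|s - t|]gtr0_norm ?subr_gt0// H// ltW.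
move=> s0 st tT; apply/ler_addgt0Pr => e e0.
have ts1 : 0 < t - s + 1 by lra.
pose e' := e / (t - s + 1).
have e'0 : 0 < e' by rewrite divr_gt0.
suff : `|phi t - phi s| <= (beta + e') * (t - s).
  have -> : e = e' * (t - s + 1) by rewrite divfK// gt_eqF.
  move=> H; apply: (le_trans H); lra.
apply: (@cousin_induction _ s t (fun x : R => `|phi x - phi s| <= (beta + e') * (x - s))) => //.
  by rewrite !subrr normr0 mulr0.
move=> z /andP[sz zt].
have [|l /cvgrPdist_le/(_ _ e'0)[r /= r0 rP] lb] := dphi z.
  by rewrite in_itv/=; apply/andP; split; lra.
have near y : s <= y -> y <= t -> `|y - z| < r ->
    `|phi y - phi z| <= (beta + e') * `|y - z|.
  move=> sy yt yr; have [->|yz] := eqVneq y z; first by rewrite !subrr normr0 mulr0.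
  have := rP y; rewrite /ball_/= distrC => /(_ yr yz); rewrite in_itv/=.
  have -> : (0 <= y <= T) by apply/andP; split; lra.
  move=> /(_ isT) H.
  have yz0 : y - z != 0 by rewrite subr_eq0.
  have -> : phi y - phi z = (l - (l - (y - z)^-1 *: (phi y - phi z))) * (y - z).
    rewrite subKr; change (phi y - phi z = (y - z)^-1 * (phi y - phi z) * (y - z)).
    by rewrite mulrAC mulVf ?mul1r.
  rewrite normrM ler_wpM2r// (le_trans (ler_normB _ _))// lerD//.
exists r => // x y sx yt rx xz zy yr Px.
have xN : `|x - z| = z - x by rewrite distrC ger0_norm// subr_ge0.
have yN : `|y - z| = y - z by rewrite ger0_norm// subr_ge0.
have := near x sx ltac:(lra); rewrite xN => /(_ ltac:(lra)) Hx.
have := near y ltac:(lra) yt; rewrite yN => /(_ ltac:(lra)) Hy.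
have -> : phi y - phi s = (phi y - phi z) - (phi x - phi z) + (phi x - phi s) by ring.
rewrite (le_trans (ler_normD _ _))// (le_trans (lerD (ler_normB _ _) (lexx _)))//.
lra.
Qed.

(** * A common descent direction *)

(** The hypothesis bounds from below, by [1 / gamma], the norm of the points of the
    convex hull [K] of the normalized vectors [n i]. If [m] in [K] nearly minimizes
    the norm, moving from [m] towards [n i] cannot decrease the norm much, which
    forces the scalar product of [n i] and [m] to be nearly the squared norm of [m]
    or larger. The factor 2 in the conclusion pays for the approximate minimum. *)
Lemma uniform_descent_direction (R : realType) (d p : nat) (P : pred 'I_p)
    (G : 'I_p -> 'rV[R]_d) (alpha gamma : R) :
  0 < alpha -> 1 <= gamma -> (forall i, P i -> alpha <= enorm (G i)) ->
  (forall lambda : 'I_p -> R, (forall i, 0 <= lambda i) ->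
     \sum_(i < p | P i) lambda i * enorm (G i) <=
     gamma * enorm (\sum_(i < p | P i) lambda i *: G i)) ->
  exists2 w : 'rV[R]_d, enorm w <= 1 &
    forall i, P i -> alpha / (2 * gamma) <= dot (G i) w.
Proof.
move=> alpha0 gamma1 Galpha Ggamma.
have [i0 Pi0|noP] := pickP P; last first.
  by exists 0 => [|i]; [rewrite enorm0 ler01|rewrite noP].
have G0 i : P i -> 0 < enorm (G i) by move=> /Galpha; exact: lt_le_trans.
pose n i := (enorm (G i))^-1 *: G i.
have n1 i : P i -> enorm (n i) = 1.
  by move=> Pi; rewrite enormZ gtr0_norm ?invr_gt0 ?G0// mulVf// gt_eqF// G0.
pose K m := exists mu : 'I_p -> R, [/\ forall i, 0 <= mu i,
  \sum_(i < p | P i) mu i = 1 & m = \sum_(i < p | P i) mu i *: n i].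
have Kn i : P i -> K (n i).
  move=> Pi; exists (fun j => (j == i)%:R); split=> [j||]; first exact: ler0n.
    rewrite (bigD1 i)//= eqxx big1 ?addr0// => j /andP[_ /negbTE ->//].
  by rewrite (bigD1 i)//= eqxx scale1r big1 ?addr0// => j /andP[_ /negbTE ->]; rewrite scale0r.
have Kconv (m m' : 'rV[R]_d) (th : R) : 0 <= th -> th <= 1 -> K m -> K m' ->
    K (m + th *: (m' - m)).
  move=> th0 th1 [mu [mu0 mu1 ->]] [mu' [mu'0 mu'1 ->]].
  exists (fun i => mu i + th * (mu' i - mu i)); split=> [i||].
  - have := mu0 i; have := mu'0 i; nra.
  - by rewrite big_split/= -mulr_sumr sumrB mu1 mu'1 subrr mulr0 addr0.
  - rewrite -sumrB scaler_sumr -big_split/=; apply: eq_bigr => i _.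
    by rewrite -scalerBl [in RHS]scalerDl -(scalerA th).
have Kle1 m : K m -> enorm m <= 1.
  move=> [mu [mu0 mu1 ->]]; rewrite (le_trans (enorm_sum _ _ _))// -mu1.
  by apply: ler_sum => i Pi; rewrite enormZ n1// mulr1 ger0_norm.
have gamma0 : 0 < gamma by lra.
have Kge m : K m -> gamma^-1 <= enorm m.
  move=> [mu [mu0 mu1 ->]].
  have := Ggamma (fun i => mu i / enorm (G i)) (fun i => divr_ge0 (mu0 i) (enorm_ge0 _)).
  rewrite (eq_bigr mu); last by move=> i Pi; rewrite divfK// gt_eqF// G0.
  rewrite mu1 (eq_bigr (fun i => mu i *: n i)) => [H|i _]; last by rewrite scalerA.
  by rewrite -(ler_pM2l gamma0) mulfV// gt_eqF.
pose S := [set dot m m | m in K].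
have hS : has_inf S.
  by split; [exists (dot (n i0) (n i0)), (n i0) => //; exact: Kn
            |exists 0 => _ [m _ <-]; exact: dot_ge0].
pose kappa := gamma^-1 ^+ 2.
have kappa0 : 0 < kappa by rewrite exprn_gt0// invr_gt0.
have kappa1 : kappa <= 1.
  by rewrite exprn_ile1 ?invr_ge0 ?(ltW gamma0)// invf_le1.
have sq_conv (a b : 'rV[R]_d) (c : R) :
    dot (a + c *: (b - a)) (a + c *: (b - a)) =
    dot a a + 2 * c * (dot b a - dot a a) + c ^+ 2 * dot (b - a) (b - a).
  by rewrite !dotE (dotC a b); ring.
(* With a step [th = kappa / 8] towards [n i], the loss
   [eps / (2 th) + 2 th] is [kappa / 2], at most half of the squared norm of [m]. *)
have eps0 : 0 < kappa ^+ 2 / 16 by rewrite divr_gt0// exprn_gt0.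
have [_ [m Km <-] mlt] := inf_adherent eps0 hS.
have m_kappa : kappa <= enorm m ^+ 2.
  by rewrite lerXn2r ?nnegrE ?enorm_ge0 ?invr_ge0 ?(ltW gamma0)// Kge.
have mn i : P i -> dot m m / 2 <= dot (n i) m.
  move=> Pi; pose th := kappa / 8.
  have th0 : 0 <= th by rewrite /th; lra.
  have th1 : th <= 1 by rewrite /th; lra.
  have : inf S <= dot (m + th *: (n i - m)) (m + th *: (n i - m)).
    apply: ge_inf; first by case: hS.
    exists (m + th *: (n i - m)) => //; apply: Kconv => //; exact: Kn.
  have : dot (n i - m) (n i - m) <= 4.
    rewrite -enorm_sqr.
    have : enorm (n i - m) <= 2.
      rewrite (le_trans (enormD _ _))// enormN n1//.
      by have := Kle1 _ Km; lra.
    by have := enorm_ge0 (n i - m); nra.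
  move: m_kappa; rewrite enorm_sqr; move: mlt.
  rewrite sq_conv.
  move: (inf S) (dot m m) (dot (n i) m) (dot (n i - m) _) => I mm nm nn.
  rewrite /th; move=> H1 H2 H3 H4.
  rewrite -(ler_pM2l kappa0); nra.
have m0 : 0 < enorm m by apply: lt_le_trans (Kge _ Km); rewrite invr_gt0.
exists ((enorm m)^-1 *: m).
  by rewrite enormZ gtr0_norm ?invr_gt0// mulVf// gt_eqF.
move=> i Pi; rewrite dotZr.
have -> : dot (G i) m = enorm (G i) * dot (n i) m.
  by rewrite dotZl mulrA mulfV ?mul1r// gt_eqF// G0.
have := mn i Pi; rewrite -enorm_sqr => H.
rewrite ler_pdivlMl//.
have mg := Kge _ Km; have Ga := Galpha i Pi.
apply: (@le_trans _ _ (enorm (G i) * (enorm m ^+ 2 / 2))); last first.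
  by rewrite ler_pM2l ?G0.
apply: (@le_trans _ _ (alpha * (enorm m ^+ 2 / 2))); last first.
  by rewrite ler_wpM2r// divr_ge0 ?sqr_ge0.
rewrite [leRHS](_ : _ = enorm m * (alpha / 2 * enorm m)); last by ring.
rewrite ler_pM2l// [leLHS](_ : _ = alpha / 2 * gamma^-1); last first.
  by field; rewrite gt_eqF.
by rewrite ler_pM2l ?divr_gt0.
Qed.

(** * Projections on the linearized constraint set *)

Section projection_on_Qtilde.
Context (R : realType) (d p : nat) (g : 'I_p -> R -> 'rV[R]_d -> R).
Implicit Types (t : R) (u x z : 'rV[R]_d).

Lemma closed_Qtilde t u : closed (Qtilde g t u).
Proof.
have -> : Qtilde g t u = \bigcap_(i in [set: 'I_p])
    ((fun z => dot (grad (g i t) u) z) @^-1`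
      [set r : R | dot (grad (g i t) u) u - g i t u <= r]).
  apply/seteqP; split => z /= H i => [_|].
    by have := H i; rewrite !dotE /=; lra.
  by have := H i I; rewrite !dotE /=; lra.
apply: closed_bigI => i _; apply: preimage_closed; last exact: closed_ge.
by move=> z _; exact: continuous_dot.
Qed.

Lemma projset_proj_Qtilde t u x : Qtilde g t u !=set0 ->
  projset (Qtilde g t u) x (Defs.proj (Qtilde g t u) x).
Proof.
by move=> ne; apply: xgetPex; apply: projset_neq0 => //; exact: closed_Qtilde.
Qed.

(** [Qtilde] is convex: the segment from the projection to [z] stays inside. *)
Lemma proj_Qtilde_variational t u x z : Qtilde g t u z ->
  dot (x - Defs.proj (Qtilde g t u) x) (z - Defs.proj (Qtilde g t u) x) <= 0.
Proof.
move=> Qz; have := @projset_proj_Qtilde t u x (ex_intro _ z Qz).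
set y := Defs.proj _ _ => /[dup] yP [Qy _].
apply: (projset_variation yP) => e /andP[e0 e1] i.
have := Qy i; have := Qz i.
have -> : dot (grad (g i t) u) (y + e *: (z - y) - u) =
  dot (grad (g i t) u) (y - u) +
  e * (dot (grad (g i t) u) (z - u) - dot (grad (g i t) u) (y - u)).
  by rewrite !dotE; ring.
nra.
Qed.

End projection_on_Qtilde.

(** * Geometry of the moving set *)

Section moving_set.
Context (R : realType) (d p : nat) (T : R)
  (g : 'I_p -> R -> 'rV[R]_d -> R) (U : 'I_p -> R -> set 'rV[R]_d)
  (c alpha beta M gamma rho : R).
Hypothesis g_convex : forall i (t : R), t \in `[0, T] ->
  convex_function [set: 'rV[R]_d] (g i t).
Hypothesis c_gt0 : 0 < c.
Hypothesis Q_dist_U : forall i (t : R), t \in `[0, T] ->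
  (c%:E < set_dist (Qi g i t) (~` U i t))%E.
Hypotheses (alpha_gt0 : 0 < alpha) (beta_gt0 : 0 < beta) (M_gt0 : 0 < M).
Hypothesis g_C2 : forall i (t : R), t \in `[0, T] -> C2_on (U i t) (g i t).
Hypothesis g_grad : forall i (t : R) x, t \in `[0, T] -> U i t x ->
  alpha <= enorm (grad (g i t) x) <= beta.
Hypothesis g_dt : forall i (t : R) x, t \in `[0, T] ->
  exists2 l : R, is_tderive T (fun s => g i s x : R^o) t l & `|l| <= beta.
Hypothesis g_hess : forall i (t : R) x, t \in `[0, T] -> U i t x ->
  opnorm (hess (g i t) x) <= M.
Hypotheses (gamma_ge1 : 1 <= gamma) (rho_gt0 : 0 < rho).
Hypothesis g_inverse_triangle : forall (t : R) x (lambda : 'I_p -> R),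
  t \in `[0, T] -> Q g t x -> (forall i, 0 <= lambda i) ->
  \sum_(i < p | g i t x <= rho) lambda i * enorm (grad (g i t) x) <=
  gamma * enorm (\sum_(i < p | g i t x <= rho) lambda i *: grad (g i t) x).

Implicit Types (t s : R) (x y z u v w : 'rV[R]_d).

Lemma Q_ge0 i t x : Q g t x -> 0 <= g i t x.
Proof. exact. Qed.

(** [Qi g i t] is separated from the complement of [U i t] by more than [c]. *)
Lemma near_U i t x y : t \in `[0, T] -> 0 <= g i t x -> enorm (y - x) <= c ->
  U i t y.
Proof.
move=> tT gx yx; apply: contrapT => Uy.
have := Q_dist_U i tT; rewrite ltNge => /negP; apply.
apply: (@le_trans _ _ (enorm (x - y))%:E); last by rewrite lee_fin enormB.
by apply: ereal_inf_lbound; exists (x, y).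
Qed.

Lemma Q_U i t x : t \in `[0, T] -> Q g t x -> U i t x.
Proof.
move=> tT Qx; apply: (near_U tT (Q_ge0 i Qx)).
by rewrite subrr enorm0 ltW.
Qed.

Lemma g_tangent i t x y : t \in `[0, T] -> U i t x ->
  g i t x + dot (grad (g i t) x) (y - x) <= g i t y.
Proof.
move=> tT Ux; apply: convex_ge_tangent; first exact: g_convex.
by have [] := g_C2 tT Ux.
Qed.

Lemma g_time i x s t : s \in `[0, T] -> t \in `[0, T] ->
  `|g i t x - g i s x| <= beta * `|t - s|.
Proof.
by apply: (@tderive_lipschitz R T beta (fun s => g i s x)) => r rT; exact: g_dt.
Qed.

Lemma grad_near i t x y : t \in `[0, T] -> Q g t x -> enorm (y - x) <= c ->
  enorm (grad (g i t) y - grad (g i t) x) <= M * enorm (y - x).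
Proof.
move=> tT Qx yx; apply: grad_lipschitz => s /andP[s0 s1].
have Us : U i t (x + s *: (y - x)).
  apply: (near_U tT (Q_ge0 i Qx)); rewrite addrAC subrr add0r enormZ ger0_norm//.
  by apply: le_trans yx; rewrite ler_piMl ?enorm_ge0.
by split; [have [] := g_C2 tT Us | exact: g_hess].
Qed.

(** The common rate at which the almost active constraints grow along the descent
    direction. *)
Definition slope := alpha / (2 * gamma).

Lemma slope_gt0 : 0 < slope.
Proof. by rewrite divr_gt0// mulr_gt0// (lt_le_trans ltr01). Qed.

(** The almost active constraints, those with [g i t x <= rho], are the ones for
    which a move along [w] is needed; the others have a margin [rho]. *)
Lemma descent_direction t x : t \in `[0, T] -> Q g t x ->
  exists2 w, enorm w <= 1 &
    forall i, g i t x <= rho -> slope <= dot (grad (g i t) x) w.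
Proof.
move=> tT Qx.
apply: (@uniform_descent_direction _ _ _ (fun i => g i t x <= rho)) => //.
  by move=> i _; have /andP[] := g_grad tT (Q_U i tT Qx).
by move=> lambda lambda0; exact: g_inverse_triangle.
Qed.

(** Over a time lapse [s] a constraint decreases by at most [beta * s], and a move
    of length [Qspeed * s] along the descent direction compensates this. *)
Definition Qspeed := beta / slope.

(** For shorter time lapses the same move cannot use up the margin [rho] of the
    constraints that are not almost active. *)
Definition Qtimescale := rho / (beta * (Qspeed + 1)).

Lemma Qspeed_gt0 : 0 < Qspeed.
Proof. by rewrite divr_gt0// slope_gt0. Qed.

Lemma Qtimescale_gt0 : 0 < Qtimescale.
Proof. by rewrite divr_gt0// mulr_gt0// addr_gt0 ?Qspeed_gt0. Qed.

Lemma dot_ge_enorm u v : - (enorm u * enorm v) <= dot u v.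
Proof. by have := dot_norm_le u v; rewrite ler_norml => /andP[]. Qed.

(** Convexity of [g i s] makes the first-order gain along the descent direction a
    true lower bound, so no curvature term limits the length of the move. *)
Lemma Q_lipschitz s t x : s \in `[0, T] -> t \in `[0, T] -> `|t - s| <= Qtimescale ->
  Q g s x -> exists2 y, Q g t y & enorm (y - x) <= Qspeed * `|t - s|.
Proof.
move=> sT tT tsh Qx; have [w w1 wP] := descent_direction sT Qx.
have L0 := Qspeed_gt0; have k0 := slope_gt0.
set tau := Qspeed * `|t - s|.
have tau0 : 0 <= tau by rewrite mulr_ge0// ltW.
exists (x + tau *: w); last first.
  by rewrite addrAC subrr add0r enormZ ger0_norm// ler_piMr.
move=> i _; rewrite /Qi/=.
have := g_time i (x + tau *: w) sT tT; rewrite ler_norml => /andP[gts _].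
have := g_tangent (x + tau *: w) sT (Q_U i sT Qx).
rewrite addrAC subrr add0r dotZr => gs.
have gx := Q_ge0 i Qx.
have [/wP kw|rhog] := leP (g i s x) rho.
  have : tau * slope = beta * `|t - s| by rewrite /tau mulrAC divfK// gt_eqF.
  have : tau * slope <= tau * dot (grad (g i s) x) w by rewrite ler_wpM2l.
  lra.
have /andP[_ gb] := g_grad sT (Q_U i sT Qx).
have gw : - beta <= dot (grad (g i s) x) w.
  apply: le_trans (dot_ge_enorm _ _); rewrite lerN2.
  by rewrite -[leRHS]mulr1 ler_pM ?enorm_ge0.
have : tau * - beta <= tau * dot (grad (g i s) x) w by rewrite ler_wpM2l.
have : beta * (Qspeed + 1) * `|t - s| <= rho.
  by rewrite mulrC -ler_pdivlMr// mulr_gt0// addr_gt0.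
have : tau * beta = beta * Qspeed * `|t - s| by rewrite /tau; ring.
lra.
Qed.

Lemma Qtilde_sub_Q t u : t \in `[0, T] -> (forall i, U i t u) ->
  Qtilde g t u `<=` Q g t.
Proof.
by move=> tT Uu z zt i _; apply: le_trans (zt i) _; exact: g_tangent.
Qed.

(** A linearized constraint is violated at a point [y] of [Q g t] by at most
    [M |u - y|^2], and grows at the rate [slope / 2] at least along the descent
    direction. *)
Definition tangent_const := 2 * M / slope.

(** Within this radius [u] stays in the sets [U i t], gradients at [u] and [y]
    differ by at most half of [slope], and the margin [rho] of the constraints that
    are not almost active is not used up. *)
Definition tangent_radius :=
  Num.min (Num.min c 1) (Num.min (slope / (2 * M)) (rho / (M + tangent_const * beta))).

Lemma tangent_const_gt0 : 0 < tangent_const.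
Proof. by rewrite divr_gt0 ?slope_gt0// mulr_gt0. Qed.

Lemma tangent_radius_gt0 : 0 < tangent_radius.
Proof.
have k0 := slope_gt0; have C0 := tangent_const_gt0.
rewrite !lt_min c_gt0 ltr01/=; apply/andP; split; apply: divr_gt0 => //.
  exact: mulr_gt0.
by apply: addr_gt0 => //; exact: mulr_gt0.
Qed.

(** The descent direction is taken at [y], where the inverse triangle inequality is
    available, and not at [u], which may lie outside [Q g t]; the Lipschitz
    continuity of the gradient transfers it to [u]. *)
Lemma Qtilde_near t y u : t \in `[0, T] -> Q g t y -> enorm (u - y) <= tangent_radius ->
  (forall i, U i t u) /\
  exists2 z, Qtilde g t u z & enorm (z - y) <= tangent_const * enorm (u - y) ^+ 2.
Proof.
move=> tT Qy; rewrite !le_min => /andP[/andP[uc u1] /andP[uk ur]].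
have k0 := slope_gt0; have C0 := tangent_const_gt0.
have Uu i : U i t u by exact: near_U tT (Q_ge0 i Qy) uc.
split=> //; have [w w1 wP] := descent_direction tT Qy.
set s := enorm (u - y) in uc u1 uk ur *.
have s0 : 0 <= s by exact: enorm_ge0.
set tau := tangent_const * s ^+ 2.
have tau0 : 0 <= tau by rewrite mulr_ge0 ?sqr_ge0// ltW.
exists (y + tau *: w); last first.
  by rewrite addrAC subrr add0r enormZ ger0_norm// ler_piMr.
move=> i.
have := g_tangent u tT (Q_U i tT Qy).
have Dg := grad_near i tT Qy uc; rewrite -/s in Dg.
set gu := grad (g i t) u in Dg *; set gy := grad (g i t) y in Dg *.
have -> : dot gu (y + tau *: w - u) = tau * dot gu w - dot gu (u - y).
  by rewrite !dotE; ring.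
(* By convexity g(u) >= g(y) + gy.(u - y), so the linearization at u, taken at y,
   is at least g(y) - (gu - gy).(u - y). *)
have Hlin : dot (gu - gy) (u - y) <= M * s ^+ 2.
  apply: le_trans (dot_le_enorm _ _) _.
  by rewrite expr2 mulrA -/s ler_wpM2r.
have Hw : - (M * s) <= dot (gu - gy) w.
  apply: le_trans (dot_ge_enorm _ _); rewrite lerN2.
  by rewrite -[leRHS]mulr1 ler_pM ?enorm_ge0.
move: Hlin Hw; rewrite !dotDl !dotNl => Hlin Hw Ht.
have gy0 := Q_ge0 i Qy.
have ss : s ^+ 2 <= s by rewrite expr2 ler_piMr.
have [/wP kw|rhog] := leP (g i t y) rho.
  rewrite -/gy in kw.
  have Ms : M * s <= slope / 2.
    by move: uk; rewrite ler_pdivlMr ?mulr_gt0//; lra.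
  have : tau * (slope / 2) <= tau * dot gu w by rewrite ler_wpM2l//; lra.
  have : tau * (slope / 2) = M * s ^+ 2.
    by rewrite /tau /tangent_const; field; rewrite gt_eqF.
  lra.
have /andP[_ gb] := g_grad tT (Uu i).
have gw : - beta <= dot gu w.
  apply: le_trans (dot_ge_enorm _ _); rewrite lerN2.
  by rewrite -[leRHS]mulr1 ler_pM ?enorm_ge0.
have : tau * - beta <= tau * dot gu w by rewrite ler_wpM2l.
have MC : 0 < M + tangent_const * beta by rewrite addr_gt0// mulr_gt0.
have : s ^+ 2 * (M + tangent_const * beta) <= rho.
  by apply: le_trans (_ : s * (M + tangent_const * beta) <= _); rewrite ?ler_pM2r// -ler_pdivlMr.
have : tau * beta = tangent_const * beta * s ^+ 2 by rewrite /tau; ring.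
lra.
Qed.

(** The summand [tangent_radius^-1] covers points [y] beyond [tangent_radius],
    for which |u - y| is itself at most a multiple of its square. *)
Definition hypo_const := tangent_const + tangent_radius^-1.

Lemma hypo_const_gt0 : 0 < hypo_const.
Proof. by rewrite addr_gt0 ?tangent_const_gt0// invr_gt0 tangent_radius_gt0. Qed.

(** The hypothesis on [v] says that [v] is normal to [Qtilde g t u] at [x]. Replace
    [y] by the point of [Qtilde g t u] provided by [Qtilde_near]: the error is
    quadratic in [u - y]. For the solution [u = x]; for the scheme [u] is the
    previous node and [x] the new one, whence the extra [dl]. *)
Lemma hypomonotone t u x y v (dl : R) : t \in `[0, T] -> Q g t y ->
  enorm (u - x) <= dl -> (forall z, Qtilde g t u z -> dot v (z - x) <= 0) ->
  dot v (y - x) <= enorm v * (hypo_const * enorm (u - y) ^+ 2 + dl).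
Proof.
move=> tT Qy uxdl vQ.
have dl0 : 0 <= dl by exact: le_trans (enorm_ge0 _) uxdl.
have r0 := tangent_radius_gt0; have C0 := tangent_const_gt0; have v0 := enorm_ge0 v.
have s0 := enorm_ge0 (u - y).
have [ur|ru] := leP (enorm (u - y)) tangent_radius.
  have [_ [z /vQ vz zy]] := Qtilde_near tT Qy ur.
  have -> : dot v (y - x) = dot v (y - z) + dot v (z - x) by rewrite -dotDr subrKA.
  have : dot v (y - z) <= enorm v * (tangent_const * enorm (u - y) ^+ 2).
    by rewrite (le_trans (dot_le_enorm _ _))// ler_wpM2l// enormB.
  have : 0 <= enorm v * (tangent_radius^-1 * enorm (u - y) ^+ 2).
    by rewrite mulr_ge0// mulr_ge0 ?sqr_ge0// invr_ge0 ltW.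
  have := mulr_ge0 v0 dl0; rewrite /hypo_const; lra.
rewrite (le_trans (dot_le_enorm _ _))// ler_wpM2l//.
rewrite (le_trans (enorm_chain u _ _))// lerD// enormB.
have : enorm (u - y) <= tangent_radius^-1 * enorm (u - y) ^+ 2.
  by rewrite ler_pdivlMl// expr2 ler_wpM2r// ltW.
have : 0 <= tangent_const * enorm (u - y) ^+ 2 by rewrite mulr_ge0 ?sqr_ge0// ltW.
rewrite /hypo_const; lra.
Qed.

(** [Qtilde g t x] is a convex subset of [Q g t] containing [x], so the segment
    from [x] to [z] lies in [Q g t] and the proximal inequality can be applied at
    its points arbitrarily close to [x]. *)
Lemma prox_normal_Qtilde t x v z : t \in `[0, T] ->
  prox_normal (Q g t) x v -> Qtilde g t x z -> dot v (z - x) <= 0.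
Proof.
move=> tT [a a0 xP] xz; have Qx : Q g t x by case: xP.
have : dot (x + a *: v - x) (z - x) <= 0.
  apply: (projset_variation xP) => e /andP[e0 e1].
  apply: (Qtilde_sub_Q tT (fun i => Q_U i tT Qx)) => i.
  rewrite addrAC subrr add0r dotZr; have := xz i; have := Q_ge0 i Qx.
  nra.
by rewrite addrAC subrr add0r dotZl pmulr_rle0.
Qed.

Lemma prox_normal_hypomonotone t x y v : t \in `[0, T] ->
  prox_normal (Q g t) x v -> Q g t y ->
  dot v (y - x) <= enorm v * (hypo_const * enorm (x - y) ^+ 2).
Proof.
move=> tT vN Qy; rewrite -[X in enorm v * X]addr0.
apply: (@hypomonotone t x x) => //; first by rewrite subrr enorm0.
by move=> z; exact: prox_normal_Qtilde.
Qed.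

(** At a slightly earlier time [s] the solution lies in [Q g s], hence at distance
    at most [Qspeed * (t - s)] from a point of [Q g t]. The normal inequality for
    this point and [s] tending to [t] bound the component of [- q'] along the normal
    vector by [Qspeed]; what remains of its squared norm is its scalar product with
    [w]. Times [s < t] are needed, which excludes [t = 0]. *)
Lemma normal_speed (q : R -> 'rV[R]_d) t w :
  (forall s, s \in `[0, T] -> Q g s (q s)) -> 0 < t <= T -> derivable q t 1 ->
  prox_normal (Q g t) (q t) (w - 'D_1 q t) ->
  enorm (w - 'D_1 q t) <= enorm w + Qspeed.
Proof.
move=> qQ /andP[t0 tT] dq; set q' := 'D_1 q t; set v := w - q' => vN.
have tT' : t \in `[0, T] by rewrite in_itv/= ltW.
have L0 := Qspeed_gt0; have C0 := hypo_const_gt0; have v0 := enorm_ge0 v.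
suff H : dot v (- q') <= Qspeed * enorm v.
  have [vz|vN0] := eqVneq (enorm v) 0; first by rewrite vz addr_ge0 ?enorm_ge0// ltW.
  have vp : 0 < enorm v by rewrite lt_def vN0.
  rewrite -(ler_pM2l vp) -expr2 enorm_sqr {2}/v dotDr.
  by rewrite mulrDr lerD ?dot_le_enorm// mulrC.
apply/ler_addgt0Pr => e e0.
pose K := Qspeed + enorm q' + 1.
have K0 : 0 < K by rewrite /K; have := enorm_ge0 q'; lra.
pose D := d%:R * enorm v + enorm v * (hypo_const * K ^+ 2) + 1.
have D0 : 0 < D.
  rewrite ltr_wpDl// addr_ge0// ?mulr_ge0// ?sqr_ge0// ltW//.
(* The difference quotient converges in the max norm; the factor [d] converts to
   the Euclidean norm. The first bound keeps the quotient bounded. *)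
pose e1 := Num.min (1 / (d%:R + 1)) (e / D).
have e10 : 0 < e1 by rewrite lt_min !divr_gt0// ltr_wpDl.
have [r r0 rP] := derivable_quotient dq e10.
pose m := Num.min (Num.min Qtimescale t) (Num.min (r / 2) (e / D)).
have m0 : 0 < m by rewrite !lt_min Qtimescale_gt0 t0 !divr_gt0.
have [mh mt mr me] : [/\ m <= Qtimescale, m <= t, m <= r / 2 & m <= e / D].
  by split; rewrite /m !ge_min lexx ?orbT.
have := rP (- m); rewrite oppr_eq0 (gt_eqF m0) normrN (gtr0_norm m0) => /(_ isT).
move=> /(_ ltac:(lra)); rewrite [_%:A]mulr1 [- m + t]addrC.
set s := t - m; set Dq := _ *: _ => Hq.
have sT : s \in `[0, T] by rewrite in_itv/=; apply/andP; split; rewrite /s; lra.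
have qs : q s - q t = - m *: Dq by rewrite scalerA mulfV ?scale1r// oppr_eq0 gt_eqF.
have ts : `|t - s| = m by rewrite /s opprB addrC subrK gtr0_norm.
have [y Qy yq] := Q_lipschitz sT tT' ltac:(rewrite ts; exact: mh) (qQ _ sT).
rewrite ts in yq.
have eDq : enorm (q' - Dq) <= d%:R * e1.
  by rewrite (le_trans (enorm_le_mx_norm _))// ler_wpM2l// ltW.
have Dq1 : enorm Dq <= enorm q' + 1.
  have -> : Dq = q' - (q' - Dq) by rewrite subKr.
  rewrite (le_trans (enormD _ _))// enormN lerD// (le_trans eDq)//.
  have := ler0n R d => d0.
  apply: (@le_trans _ _ (d%:R * (1 / (d%:R + 1)))).
    by rewrite ler_wpM2l// /e1 ge_min lexx.
  by rewrite mul1r ler_pdivrMr ?mul1r ?lerDl// ltr_wpDl.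
have yK : enorm (q t - y) <= K * m.
  rewrite (le_trans (enorm_chain (q s) _ _))//.
  rewrite (enormB (q t)) qs enormZ normrN gtr0_norm// (enormB (q s)).
  have : m * enorm Dq <= m * (enorm q' + 1) by rewrite ler_pM2l.
  rewrite /K; lra.
have vy := prox_normal_hypomonotone tT' vN Qy.
have vys : dot v (q s - q t) <= enorm v * (Qspeed * m) + enorm v * (hypo_const * (K * m) ^+ 2).
  rewrite -(subrKA y) dotDr lerD//.
    by rewrite (le_trans (dot_le_enorm _ _))// ler_wpM2l// enormB.
  apply: (le_trans vy); rewrite ler_wpM2l// ler_wpM2l// ?(ltW C0)//.
  by rewrite lerXn2r// ?nnegrE ?enorm_ge0// mulr_ge0// ltW.
move: vys; rewrite qs dotZr mulNr => vys.
have vDq : - dot v Dq <= enorm v * Qspeed + enorm v * (hypo_const * K ^+ 2) * m.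
  by rewrite -(ler_pM2l m0); lra.
have := dot_le_enorm v (Dq - q'); rewrite dotDr dotNr (enormB Dq) => vDq'.
have : enorm v * enorm (q' - Dq) <= enorm v * (d%:R * (e / D)).
  rewrite ler_wpM2l// (le_trans eDq)// ler_wpM2l//.
  by rewrite /e1 ge_min lexx orbT.
have : enorm v * (hypo_const * K ^+ 2) * m <= enorm v * (hypo_const * K ^+ 2) * (e / D).
  by rewrite ler_wpM2l// mulr_ge0// mulr_ge0 ?sqr_ge0// ltW.
have : D * (e / D) = e by rewrite mulrC divfK// gt_eqF.
have : 0 < e / D by rewrite divr_gt0.
move: (e / D) => eta; rewrite /D. move: vDq vDq'; move: (dot v q') (dot v Dq) => a b; lra.
Qed.

(** * One step of the scheme *)

(** The length, per unit of time, of a move from a point of [Q g s] to a point of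
    [Qtilde g t] linearized at this point: [Qspeed] to reach [Q g t], and a
    quadratic correction in which one factor is bounded by [tangent_radius]. *)
Definition step_cost := Qspeed * (1 + tangent_const * tangent_radius).

Lemma step_cost_gt0 : 0 < step_cost.
Proof.
by rewrite mulr_gt0 ?Qspeed_gt0// addr_gt0// mulr_gt0 ?tangent_const_gt0 ?tangent_radius_gt0.
Qed.

(** The projection is compared with the point of the linearized set obtained by
    going from [u] to [Q g t] and from there to [Qtilde g t u]; in particular this
    set is nonempty, so that [proj] takes no default value. *)
Lemma scheme_step s t u F : s \in `[0, T] -> t \in `[0, T] ->
  `|t - s| <= Qtimescale -> Qspeed * `|t - s| <= tangent_radius -> Q g s u ->
  let u' := Defs.proj (Qtilde g t u) (u + F) in
  [/\ Q g t u', forall z, Qtilde g t u z -> dot (u + F - u') (z - u') <= 0 &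
      enorm (u + F - u') <= enorm F + step_cost * `|t - s|].
Proof.
move=> sT tT tsh tsr Qu u'.
have [y Qy yu] := Q_lipschitz sT tT tsh Qu.
have uy : enorm (u - y) <= tangent_radius by rewrite enormB (le_trans yu).
have [Uu [z Qz zy]] := Qtilde_near tT Qy uy.
have u'P : projset (Qtilde g t u) (u + F) u'.
  by apply: projset_proj_Qtilde; exists z.
split; first by apply: (Qtilde_sub_Q tT Uu); case: u'P.
  by move=> ?; exact: proj_Qtilde_variational.
rewrite (le_trans (projset_prox u'P Qz))// (addrC u) -addrA.
rewrite (le_trans (enormD _ _))// lerD2l.
have uyL : enorm (u - y) <= Qspeed * `|t - s| by rewrite enormB.
have : enorm (z - y) <= tangent_const * (tangent_radius * (Qspeed * `|t - s|)).
  rewrite (le_trans zy)// expr2 ler_pM2l ?tangent_const_gt0//.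
  by rewrite ler_pM ?enorm_ge0.
have := enorm_chain y u z; rewrite (enormB y z) /step_cost; lra.
Qed.

Context (f : R -> 'rV[R]_d -> 'rV[R]_d) (Kf Lf Hf : R) (q0 : 'rV[R]_d).
Hypotheses (Kf_gt0 : 0 < Kf) (Lf_gt0 : 0 < Lf) (Hf_gt0 : 0 < Hf).
Hypothesis f_lipschitz : forall (t : R) x y, t \in `[0, T] ->
  (\bigcup_(tau in `[0, T]) Q g tau) x ->
  (\bigcup_(tau in `[0, T]) Q g tau) y ->
  enorm (f t x - f t y) <= Kf * enorm (x - y).
Hypothesis f_growth : forall (t : R) x, t \in `[0, T] ->
  (\bigcup_(tau in `[0, T]) Q g tau) x ->
  enorm (f t x) <= Lf * (1 + enorm x).
Hypothesis f_holder : forall (t s : R) x, t \in `[0, T] -> s \in `[0, T] ->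
  (\bigcup_(tau in `[0, T]) Q g tau) x ->
  enorm (f t x - f s x) <= Hf * Num.sqrt `|t - s|.
Hypothesis q0_in : Q g 0 q0.

Lemma bigcup_Q t x : t \in `[0, T] -> Q g t x -> (\bigcup_(tau in `[0, T]) Q g tau) x.
Proof. by move=> tT Qx; exists t. Qed.

(** * Rate of growth of the squared error *)

Section energy_rate.
Context (V W V2 : R).

Definition energy_const :=
  Kf * (1 + W) + Hf + V * (Qspeed + 2 * W + 2 * hypo_const * (1 + (W + Qspeed) ^+ 2)) +
  V2 * (W + Qspeed + 2 * hypo_const * (1 + (W + Qspeed) ^+ 2)).

(** [b] is the interpolated value at time [t] between the nodes [u] at [s] and [u']
    at [t'], and [x] the solution at [t]. The three parts of the scalar product are
    treated separately: the perturbations by Lipschitz and Hoelder continuity, and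
    each normal vector by [hypomonotone] tested against a point of the set to which
    the other curve is close. For [w] this is a point of [Q g t'] near [x]; for [v]
    a point of [Q g t] near [u']. *)
Lemma energy_rate (h s t t' : R) u u' b x w v :
  0 < h -> h <= 1 -> h <= Qtimescale -> s \in `[0, T] -> t \in `[0, T] -> t' \in `[0, T] ->
  `|t - s| <= h -> `|t' - t| <= h ->
  Q g s u -> Q g t' u' -> Q g t x ->
  enorm (b - u) <= W * h -> enorm (b - u') <= W * h -> enorm (u - u') <= W * h ->
  enorm w <= V -> (forall z, Qtilde g t' u z -> dot w (z - u') <= 0) ->
  enorm v <= V2 -> prox_normal (Q g t) x v ->
  dot (b - x) ((f s u - w) - (f t x - v)) <= energy_const * (dot (b - x) (b - x) + h).
Proof.
move=> h_gt0 h1 hh0 sT tT tT' ts t't Qu Qu' Qx bu bu' uu' wV wN vV vN.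
have L0 := Qspeed_gt0; have C0 := hypo_const_gt0.
have W0 : 0 <= W by rewrite -(pmulr_lge0 _ h_gt0) (le_trans (enorm_ge0 _) bu).
have V0 : 0 <= V by exact: le_trans (enorm_ge0 _) wV.
have V20 : 0 <= V2 by exact: le_trans (enorm_ge0 _) vV.
rewrite -enorm_sqr; set e := enorm (b - x).
have e0 : 0 <= e by exact: enorm_ge0.
set A := W + Qspeed.
have A0 : 0 <= A by rewrite addr_ge0// ltW.
have hh : h ^+ 2 <= h by rewrite expr2 ler_piMr// ltW.
(* all distances met below are at most |b - x| plus a multiple of h *)
have sqA (r : R) : 0 <= r -> r <= e + A * h -> r ^+ 2 <= 2 * (1 + A ^+ 2) * (e ^+ 2 + h).
  move=> r0 re; apply: (@le_trans _ _ ((e + A * h) ^+ 2)).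
    by rewrite lerXn2r// nnegrE// addr_ge0// mulr_ge0// ltW.
  have H1 : (e + A * h) ^+ 2 <= 2 * e ^+ 2 + 2 * (A ^+ 2 * h ^+ 2).
    have := sqr_ge0 (e - A * h); rewrite !expr2; lra.
  have H2 : A ^+ 2 * h ^+ 2 <= A ^+ 2 * h by rewrite ler_wpM2l ?sqr_ge0.
  have H3 : 0 <= A ^+ 2 * e ^+ 2 by rewrite mulr_ge0 ?sqr_ge0.
  lra.
set S := e ^+ 2 + h in sqA *.
have S0 : 0 <= S by rewrite addr_ge0 ?sqr_ge0// ltW.
have hS : h <= S by rewrite /S lerDr sqr_ge0.
have eS : e ^+ 2 <= S by rewrite /S lerDl ltW.
have ehS : e * h <= S.
  have := sqr_ge0 (e - h); have := sqr_ge0 e; rewrite /S !expr2; move: hh; rewrite expr2; lra.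
have esS : e * Num.sqrt h <= S.
  have := sqr_ge0 (e - Num.sqrt h); have := sqr_ge0 e; have := sqr_sqrtr (ltW h_gt0).
  rewrite /S !expr2; lra.
have f_part : dot (b - x) (f s u - f t x) <= (Kf * (1 + W) + Hf) * S.
  rewrite (le_trans (dot_le_enorm _ _))// -/e.
  have : enorm (f s u - f t x) <= Kf * (e + W * h) + Hf * Num.sqrt h.
    rewrite (le_trans (enorm_chain (f s x) _ _))// lerD//.
      rewrite (le_trans (f_lipschitz sT (bigcup_Q sT Qu) (bigcup_Q tT Qx)))//.
      rewrite ler_pM2l// [leRHS]addrC (le_trans (enorm_chain b _ _))// lerD2r.
      by rewrite enormB.
    rewrite (le_trans (f_holder sT tT (bigcup_Q tT Qx)))//.
    by rewrite ler_pM2l// ler_wsqrtr// distrC.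
  move=> /(ler_wpM2l e0) H; apply: (le_trans H).
  have : Kf * e ^+ 2 <= Kf * S by rewrite ler_pM2l.
  have : Kf * W * (e * h) <= Kf * W * S by rewrite ler_wpM2l// mulr_ge0// ltW.
  have : Hf * (e * Num.sqrt h) <= Hf * S by rewrite ler_pM2l.
  rewrite expr2; lra.
have w_part : dot w (x - b) <=
    V * (Qspeed + 2 * W + 2 * hypo_const * (1 + A ^+ 2)) * S.
  have [y Qy yx] := Q_lipschitz tT tT' (le_trans t't hh0) Qx.
  have yxh : enorm (y - x) <= Qspeed * h by rewrite (le_trans yx)// ler_pM2l.
  have uy : enorm (u - y) ^+ 2 <= 2 * (1 + A ^+ 2) * S.
    apply: sqA; first exact: enorm_ge0.
    rewrite (le_trans (enorm_chain b _ _))//.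
    rewrite (le_trans (lerD (lexx _) (enorm_chain x _ _)))// -/e.
    by rewrite (enormB x) (enormB u) /A; lra.
  have -> : dot w (x - b) = dot w (x - y) + dot w (y - u') + dot w (u' - b).
    by rewrite -!dotDr !subrKA.
  have w1 : dot w (x - y) <= V * (Qspeed * h).
    by rewrite (le_trans (dot_le_enorm _ _))// ler_pM ?enorm_ge0// enormB.
  have w2 : dot w (u' - b) <= V * (W * h).
    by rewrite (le_trans (dot_le_enorm _ _))// ler_pM ?enorm_ge0// enormB.
  have w3 : dot w (y - u') <= V * (hypo_const * (2 * (1 + A ^+ 2) * S) + W * h).
    rewrite (le_trans (hypomonotone tT' Qy uu' wN))// ler_pM ?enorm_ge0//.
      by apply: addr_ge0; apply: mulr_ge0; rewrite ?sqr_ge0// ltW.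
    by rewrite lerD2r ler_pM2l.
  have : V * (Qspeed + 2 * W) * h <= V * (Qspeed + 2 * W) * S.
    by apply: ler_wpM2l => //; apply: mulr_ge0 => //; lra.
  lra.
have v_part : dot v (b - x) <= V2 * (A + 2 * hypo_const * (1 + A ^+ 2)) * S.
  have [y Qy yu'] := Q_lipschitz tT' tT ltac:(by rewrite distrC (le_trans t't)) Qu'.
  have yuh : enorm (y - u') <= Qspeed * h.
    by rewrite (le_trans yu')// ler_pM2l// distrC.
  have byA : enorm (b - y) <= A * h.
    rewrite (le_trans (enorm_chain u' _ _))// (enormB u') /A; lra.
  have xy : enorm (x - y) ^+ 2 <= 2 * (1 + A ^+ 2) * S.
    apply: sqA; first exact: enorm_ge0.
    by rewrite (le_trans (enorm_chain b _ _))// (enormB x) lerD2l.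
  have -> : dot v (b - x) = dot v (b - y) + dot v (y - x).
    by rewrite -dotDr subrKA.
  have v1 : dot v (b - y) <= V2 * (A * h).
    by rewrite (le_trans (dot_le_enorm _ _))// ler_pM ?enorm_ge0.
  have v2 : dot v (y - x) <= V2 * (hypo_const * (2 * (1 + A ^+ 2) * S)).
    rewrite (le_trans (prox_normal_hypomonotone tT vN Qy))// ler_pM ?enorm_ge0//.
      by apply: mulr_ge0; rewrite ?sqr_ge0// ltW.
    by rewrite ler_pM2l.
  have : V2 * A * h <= V2 * A * S by rewrite ler_wpM2l// mulr_ge0.
  lra.
have -> : dot (b - x) ((f s u - w) - (f t x - v)) =
    dot (b - x) (f s u - f t x) + dot w (x - b) + dot v (b - x).
  by rewrite !dotE (dotC b w) (dotC b v) (dotC x w) (dotC x v); ring.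
rewrite /energy_const -/A; lra.
Qed.

End energy_rate.

(** * A priori bounds on the scheme *)

(** Each step multiplies [enorm (u k) + 1] by at most [1 + growth * h]. *)
Definition growth := 2 * Lf + step_cost.
Definition scheme_sup := (enorm q0 + 1) * expR (growth * T).
Definition scheme_normal_sup := Lf * scheme_sup + step_cost.
Definition scheme_step_sup := scheme_normal_sup + Lf * scheme_sup.

Section mesh.
Context (n : nat) (h : R).
Hypotheses (h_gt0 : 0 < h) (h_le1 : h <= 1) (h_le_timescale : h <= Qtimescale)
  (h_radius : Qspeed * h <= tangent_radius) (nhT : n%:R * h = T).
Local Notation u := (scheme g f h q0).
Local Notation tk k := (k%:R * h).

Lemma mesh_in k : (k <= n)%N -> tk k \in `[0, T].
Proof.
move=> kn; rewrite in_itv/= mulr_ge0 ?ler0n ?(ltW h_gt0)//=.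
by rewrite -nhT ler_pM2r// ler_nat.
Qed.

Lemma mesh_gap k : `|tk k.+1 - tk k| = h.
Proof. by rewrite -mulrBl -natrB// subSnn mul1r gtr0_norm. Qed.

Lemma growth_gt0 : 0 < growth.
Proof. by rewrite addr_gt0 ?step_cost_gt0// mulr_gt0. Qed.

Lemma scheme_stepk k : (k < n)%N -> Q g (tk k) (u k) ->
  [/\ Q g (tk k.+1) (u k.+1),
      forall z, Qtilde g (tk k.+1) (u k) z ->
        dot (u k + h *: f (tk k) (u k) - u k.+1) (z - u k.+1) <= 0 &
      enorm (u k + h *: f (tk k) (u k) - u k.+1) <=
        h * (enorm (f (tk k) (u k)) + step_cost)].
Proof.
move=> kn Qu; have kT := mesh_in (ltnW kn); have k1T := mesh_in kn.
have := @scheme_step _ _ (u k) (h *: f (tk k) (u k)) kT k1T.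
rewrite mesh_gap => /(_ h_le_timescale h_radius Qu)[? ? ?]; split => //.
by rewrite mulrDr (mulrC h step_cost) -[X in X * enorm _]gtr0_norm// -enormZ.
Qed.

Lemma scheme_Q_bound k : (k <= n)%N ->
  Q g (tk k) (u k) /\ enorm (u k) + 1 <= (enorm q0 + 1) * expR (growth * tk k).
Proof.
elim: k => [_|k IH kn]; first by rewrite mul0r mulr0 expR0 mulr1.
have [Qu ub] := IH (ltnW kn); have [Qu1 _ un] := scheme_stepk kn Qu.
split=> //.
have fk := f_growth (mesh_in (ltnW kn)) (bigcup_Q (mesh_in (ltnW kn)) Qu).
have u1 : enorm (u k.+1) <= enorm (u k) + h * enorm (f (tk k) (u k)) +
    h * (enorm (f (tk k) (u k)) + step_cost).
  rewrite -[X in enorm X <= _](subKr (u k + h *: f (tk k) (u k))).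
  rewrite (le_trans (enormD _ _))// enormN lerD//.
  by rewrite (le_trans (enormD _ _))// enormZ (gtr0_norm h_gt0).
have e1 := expR_ge1Dx (growth * h).
apply: (@le_trans _ _ ((enorm (u k) + 1) * (1 + growth * h))).
  have hf : h * enorm (f (tk k) (u k)) <= h * (Lf * (1 + enorm (u k))).
    by rewrite ler_pM2l.
  have : 0 <= h * step_cost * enorm (u k).
    by rewrite mulr_ge0 ?enorm_ge0// mulr_ge0 ?ltW// step_cost_gt0.
  rewrite /growth; lra.
have -> : growth * tk k.+1 = growth * tk k + growth * h.
  by rewrite -natr1; ring.
rewrite expRD mulrA ler_pM// ?addr_ge0 ?enorm_ge0//.
by rewrite mulr_ge0 ?ltW// growth_gt0.
Qed.

Lemma scheme_bound k : (k <= n)%N -> enorm (u k) + 1 <= scheme_sup.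
Proof.
move=> kn; have [_ H] := scheme_Q_bound kn; rewrite (le_trans H)//.
rewrite ler_wpM2l ?addr_ge0 ?enorm_ge0// ler_expR ler_pM2l ?growth_gt0//.
by have := mesh_in kn; rewrite in_itv/= => /andP[].
Qed.

(** The scheme reads [u k.+1 = u k + h (f - scheme_normal k)], as the solution
    satisfies [q' = f - v]. *)
Definition scheme_normal k := h^-1 *: (u k + h *: f (tk k) (u k) - u k.+1).

Lemma scheme_normalP k : (k < n)%N ->
  [/\ enorm (scheme_normal k) <= scheme_normal_sup,
      forall z, Qtilde g (tk k.+1) (u k) z ->
        dot (scheme_normal k) (z - u k.+1) <= 0,
      enorm (u k - u k.+1) <= scheme_step_sup * h &
      h^-1 *: (u k.+1 - u k) = f (tk k) (u k) - scheme_normal k].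
Proof.
move=> kn; have [Qu _] := scheme_Q_bound (ltnW kn).
have [Qu1 un vn] := scheme_stepk kn Qu.
have fk := f_growth (mesh_in (ltnW kn)) (bigcup_Q (mesh_in (ltnW kn)) Qu).
have ub := scheme_bound (ltnW kn).
have fb : enorm (f (tk k) (u k)) <= Lf * scheme_sup.
  by rewrite (le_trans fk)// ler_pM2l// addrC.
have hV : h * (enorm (f (tk k) (u k)) + step_cost) <= h * scheme_normal_sup by rewrite ler_pM2l// lerD2r.
split.
- rewrite enormZ gtr0_norm ?invr_gt0// ler_pdivrMl//; exact: le_trans hV.
- by move=> z /un H; rewrite dotZl pmulr_rle0// invr_gt0.
- have -> : u k - u k.+1 = (u k + h *: f (tk k) (u k) - u k.+1) - h *: f (tk k) (u k).
    by rewrite [RHS]addrAC addrK.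
  rewrite (le_trans (enormD _ _))// enormN enormZ (gtr0_norm h_gt0).
  have : h * enorm (f (tk k) (u k)) <= h * (Lf * scheme_sup) by rewrite ler_pM2l.
  by rewrite /scheme_step_sup; lra.
- rewrite /scheme_normal (addrAC (u k)) [in RHS]scalerDr scalerA mulVf ?gt_eqF// scale1r.
  by rewrite opprD addrCA subrr addr0 -scalerN opprB.
Qed.

(** * Comparison of the two evolutions *)

Section comparison.
Context (q : R -> 'rV[R]_d) (B : R).
Hypothesis T_gt0 : 0 < T.
Hypothesis q_sol : sweeping_solution g f T q0 q.
Hypothesis q_le : forall t, 0 <= t <= T -> enorm (q t) <= B.

Definition sol_normal_sup := Lf * (1 + B) + Qspeed.
Definition error_rate := energy_const scheme_normal_sup scheme_step_sup sol_normal_sup.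

Definition gap k t := u k + (t / h - k%:R) *: (u k.+1 - u k) - q t.

Lemma scheme_normal_sup_ge0 : 0 <= scheme_normal_sup.
Proof.
rewrite addr_ge0 ?(ltW step_cost_gt0)// mulr_ge0 ?(ltW Lf_gt0)//.
by rewrite mulr_ge0 ?expR_ge0// addr_ge0 ?enorm_ge0.
Qed.

Lemma scheme_step_sup_ge0 : 0 <= scheme_step_sup.
Proof.
rewrite addr_ge0 ?scheme_normal_sup_ge0// mulr_ge0 ?(ltW Lf_gt0)//.
by rewrite mulr_ge0 ?expR_ge0// addr_ge0 ?enorm_ge0.
Qed.

Lemma sol_normal_sup_ge0 : 0 <= sol_normal_sup.
Proof.
rewrite addr_ge0 ?(ltW Qspeed_gt0)// mulr_ge0 ?(ltW Lf_gt0)// addr_ge0//.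
by apply: le_trans (enorm_ge0 (q 0)) (q_le _); rewrite lexx ltW.
Qed.

Lemma error_rate_ge0 : 0 <= error_rate.
Proof.
have V0 := scheme_normal_sup_ge0; have W0 := scheme_step_sup_ge0; have S0 := sol_normal_sup_ge0.
have L0 := ltW Qspeed_gt0; have C0 := ltW hypo_const_gt0.
have C1 : 0 <= 2 * hypo_const * (1 + (scheme_step_sup + Qspeed) ^+ 2).
  by rewrite !mulr_ge0// addr_ge0 ?sqr_ge0.
rewrite /error_rate /energy_const; apply: addr_ge0.
  apply: addr_ge0.
    apply: addr_ge0; last exact: ltW.
    by apply: mulr_ge0; [exact: ltW | rewrite addr_ge0].
  by apply: mulr_ge0 => //; lra.
by apply: mulr_ge0 => //; lra.
Qed.

Lemma mesh_itv k t : (k < n)%N -> tk k <= t <= tk k.+1 ->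
  [/\ t \in `[0, T], 0 <= t / h - k%:R & t / h - k%:R <= 1].
Proof.
move=> kn /andP[kt tk1]; split.
- have := mesh_in (ltnW kn); have := mesh_in kn; rewrite !in_itv/=.
  by move=> /andP[_ ?] /andP[? _]; apply/andP; split; lra.
- by rewrite subr_ge0 ler_pdivlMr.
- by rewrite lerBlDr ler_pdivrMr// addrC natr1.
Qed.

(** [energy_rate] applied to the discrete and continuous velocities
    [f - scheme_normal k] and [f - v]. *)
Lemma gap_rate k t : (k < n)%N -> tk k <= t <= tk k.+1 -> 0 < t ->
  derivable q t 1 -> prox_normal (Q g t) (q t) (f t (q t) - 'D_1 q t) ->
  derivable (gap k) t 1 /\
  dot (gap k t) ('D_1 (gap k) t) <= error_rate * (dot (gap k t) (gap k t) + h).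
Proof.
move=> kn /[dup] ktk1 /andP[kt tk1] t0 dq vN.
have [tT th0 th1] := mesh_itv kn ktk1.
have [_ qQ _ _] := q_sol.
have [wV wN uW Du] := scheme_normalP kn.
have [Qu _] := scheme_Q_bound (ltnW kn); have [Qu1 _] := scheme_Q_bound kn.
set th := t / h - k%:R in th0 th1.
have dgap : is_derive t 1 (gap k) (h^-1 *: (u k.+1 - u k) - 'D_1 q t).
  have dq' := derivableP dq.
  exact: (is_deriveB (is_derive_affine (u k) (u k.+1 - u k) h k%:R t) dq').
have tT2 : 0 < t <= T by rewrite t0; move: tT; rewrite in_itv/= => /andP[].
split; first exact: ex_derive.
rewrite derive_val Du.
rewrite -[X in dot _ (_ - X) <= _](subKr (f t (q t))).
have Wh : enorm (u k.+1 - u k) <= scheme_step_sup * h by rewrite enormB.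
have Wh0 : 0 <= scheme_step_sup * h by rewrite mulr_ge0 ?scheme_step_sup_ge0 ?ltW.
have step : `|tk k.+1 - t| <= h /\ `|t - tk k| <= h.
  have : tk k.+1 - tk k = h by rewrite -mulrBl -natrB// subSnn mul1r.
  by rewrite !ger0_norm ?subr_ge0//; split; lra.
apply: (@energy_rate scheme_normal_sup scheme_step_sup sol_normal_sup h (tk k) t (tk k.+1) (u k) (u k.+1)) => //;
  rewrite ?(mesh_in (ltnW kn)) ?(mesh_in kn)//.
- by case: step.
- by case: step.
- exact: qQ.
- rewrite addrAC subrr add0r enormZ ger0_norm//.
  by rewrite (le_trans _ Wh)// ler_piMl ?enorm_ge0.
- rewrite (_ : _ - _ = (th - 1) *: (u k.+1 - u k)); last first.
    by rewrite [in RHS]scalerBl scale1r opprB addrAC addrC.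
  rewrite enormZ (le_trans _ Wh)// ler_piMl ?enorm_ge0//.
  by rewrite ler_norml; apply/andP; split; lra.
- apply: le_trans (normal_speed qQ tT2 dq vN) _.
  rewrite lerD2r (le_trans (f_growth tT (bigcup_Q tT (qQ _ tT))))//.
  by rewrite ler_pM2l// lerD2l q_le//; move: tT; rewrite in_itv.
Qed.

Lemma gap_left k : gap k (tk k) = u k - q (tk k).
Proof. by rewrite /gap mulfK ?gt_eqF// subrr scale0r addr0. Qed.

Lemma gap_right k : gap k (tk k.+1) = u k.+1 - q (tk k.+1).
Proof.
have k1 : k.+1%:R - k%:R = 1 :> R by rewrite -natr1 addrAC subrr add0r.
by rewrite /gap mulfK ?gt_eqF// k1 scale1r (addrC (u k)) subrK.
Qed.

(** The time 0, at which [normal_speed] fails, is added to the negligible set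
    where the differential inclusion fails. *)
Lemma gap_interval k t : (k < n)%N -> tk k <= t <= tk k.+1 ->
  dot (gap k t) (gap k t) + h <=
  expR (2 * error_rate * (t - tk k)) * (dot (u k - q (tk k)) (u k - q (tk k)) + h).
Proof.
move=> kn ktk1; have [tT _ _] := mesh_itv kn ktk1; move/andP: ktk1 => [kt tk1].
have [q_ac qQ _ q_ae] := q_sol.
have [kT0 _] : 0 <= tk k /\ tk k <= T.
  by have := mesh_in (ltnW kn); rewrite in_itv/= => /andP[].
rewrite -gap_left.
apply: (gronwall_ac q_ac (S := scheme_step_sup)) => //.
- by move: tT; rewrite in_itv/= => /andP[].
- exact: error_rate_ge0.
- exact: scheme_step_sup_ge0.
- exact: ltW.
- move=> x y kx xy yt; have [_ _ uW _] := scheme_normalP kn.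
  have -> : gap k y - gap k x = ((y - x) / h) *: (u k.+1 - u k) - (q y - q x).
    by rewrite /gap; apply/rowP => j; rewrite !mxE; ring.
  rewrite (le_trans (enormD _ _))// enormN lerD2r enormZ.
  rewrite ger0_norm ?divr_ge0 ?subr_ge0 ?(ltW h_gt0)//.
  rewrite mulrC mulrA ler_pdivrMr// -mulrA (mulrC _ h) mulrA ler_wpM2r ?subr_ge0//.
  by rewrite enormB.
have zero_null : (@lebesgue_measure R).-negligible [set 0 : R].
  by exists [set 0]; split=> //; rewrite lebesgue_measure_set1.
apply: negligibleS (negligibleU q_ae zero_null) => s /= H.
have [s0|s0] := pselect (s = 0); [by right|left => Hae; apply: H => kst].
have tn : tk k <= s <= tk k.+1.
  by move/andP: kst => [-> st]/=; exact: le_trans st tk1.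
have [sT _ _] := mesh_itv kn tn.
have s_gt0 : 0 < s.
  rewrite lt_def; move: sT; rewrite in_itv/= => /andP[-> _]; rewrite andbT.
  exact/eqP.
have [dq vN] : derivable q s 1 /\ prox_normal (Q g s) (q s) (f s (q s) - q^`()%classic s).
  exact: Hae.
rewrite derive1E in vN; exact: gap_rate kn tn s_gt0 dq vN.
Qed.

Lemma node_error k : (k <= n)%N ->
  dot (u k - q (tk k)) (u k - q (tk k)) + h <= expR (2 * error_rate * tk k) * h.
Proof.
have [_ _ q00 _] := q_sol.
elim: k => [_|k IH kn].
  by rewrite mul0r q00 subrr dot0l add0r mulr0 expR0 mul1r.
have ktk1 : tk k <= tk k.+1 <= tk k.+1 by rewrite lexx ler_pM2r// ler_nat leqnSn.
rewrite -gap_right (le_trans (gap_interval kn ktk1))//.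
apply: (@le_trans _ _ (expR (2 * error_rate * (tk k.+1 - tk k)) * (expR (2 * error_rate * tk k) * h))).
  by rewrite ler_pM2l ?expR_gt0// IH// ltnW.
by rewrite mulrA -expRD -mulrDr subrK.
Qed.

(** At the final time [truncn (t / h)] is [n], the index of a node that starts no
    interval of the mesh; there the error at the last node is used. *)
Lemma interpolate_error t : t \in `[0, T] ->
  enorm (interpolate h u t - q t) <= expR (error_rate * T) * Num.sqrt h.
Proof.
move=> tT; have C0 := error_rate_ge0.
have [t0 tT'] : 0 <= t /\ t <= T by move: tT; rewrite in_itv/= => /andP[].
suff H : dot (interpolate h u t - q t) (interpolate h u t - q t) + h <=
    expR (2 * error_rate * t) * h.
  rewrite -ler_sqr ?nnegrE ?enorm_ge0 ?mulr_ge0 ?expR_ge0 ?sqrtr_ge0//.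
  rewrite enorm_sqr exprMn sqr_sqrtr ?(ltW h_gt0)// expr2 -expRD.
  apply: (@le_trans _ _ (expR (2 * error_rate * t) * h)); first by move: h_gt0 H; lra.
  rewrite ler_pM2r// ler_expR (_ : error_rate * T + _ = 2 * error_rate * T); last by ring.
  by rewrite ler_wpM2l// mulr_ge0.
rewrite /interpolate; set k := Num.truncn (t / h).
have th0 : 0 <= t / h by rewrite divr_ge0 ?(ltW h_gt0).
have /andP[kt tk1] := truncn_itv th0; rewrite -/k in kt tk1.
have kt' : tk k <= t by rewrite -ler_pdivlMr.
have [tk_lt|nk] := ltnP k n.
  have tk1' : t <= tk k.+1 by rewrite -ler_pdivrMr// ltW.
  have := gap_interval tk_lt (introT andP (conj kt' tk1')); rewrite /gap => H.
  apply: (le_trans H).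
  apply: (@le_trans _ _ (expR (2 * error_rate * (t - tk k)) * (expR (2 * error_rate * tk k) * h))).
    by rewrite ler_pM2l ?expR_gt0// node_error// ltnW.
  by rewrite mulrA -expRD -mulrDr subrK.
have nt : T <= t by rewrite -nhT (le_trans _ kt')// ler_pM2r// ler_nat.
have tE : t = T by apply/eqP; rewrite eq_le tT'.
have thn : t / h = n%:R by rewrite tE -nhT mulfK// gt_eqF.
have kn : k = n.
  by apply: truncn_def; rewrite thn lexx ltr_nat ltnSn.
rewrite kn thn subrr scale0r addr0.
have -> : t = tk n by rewrite nhT.
exact: node_error.
Qed.

End comparison.
End mesh.

End moving_set.

(** * The error estimate *)

Lemma Linfty_norm_le (R : realType) (d : nat) (T : R) (v : R -> 'rV[R]_d) (b : R) :
  (forall t, t \in `[0, T] -> enorm (v t) <= b) -> 0 <= b ->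
  (Linfty_norm T v <= b%:E)%E.
Proof.
move=> vb b0; rewrite /Linfty_norm unlock /Lnorm; case: ifPn => _; last by rewrite lee_fin.
apply/ess_supP; apply: nearW => t /=; rewrite lee_fin patchE.
case: ifPn => [|_]; last by rewrite normr0.
by rewrite inE/= => /vb H; rewrite ger0_norm ?enorm_ge0.
Qed.

Theorem theorem1p1 (R : realType) (d p : nat) (T : R)
  (g : 'I_p -> R -> 'rV[R]_d -> R) (U : 'I_p -> R -> set 'rV[R]_d)
  (c alpha beta M gamma rho : R)
  (f : R -> 'rV[R]_d -> 'rV[R]_d) (Kf Lf Hf : R)
  (q0 : 'rV[R]_d) (q : R -> 'rV[R]_d)
  (T_gt0 : 0 < T)
  (g_convex : forall i (t : R), t \in `[0, T] -> convex_function [set: 'rV[R]_d] (g i t))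
  (Q_neq0 : forall t : R, t \in `[0, T] -> Q g t !=set0)
  (c_gt0 : 0 < c)
  (U_open : forall i (t : R), t \in `[0, T] -> open (U i t))
  (Q_sub_U : forall i (t : R), t \in `[0, T] -> Qi g i t `<=` U i t)
  (Q_dist_U : forall i (t : R), t \in `[0, T] ->
     (c%:E < set_dist (Qi g i t) (~` U i t))%E)
  (alpha_gt0 : 0 < alpha) (beta_gt0 : 0 < beta) (M_gt0 : 0 < M)
  (g_C2 : forall i (t : R), t \in `[0, T] -> C2_on (U i t) (g i t))
  (g_grad : forall i (t : R) x, t \in `[0, T] -> U i t x ->
     alpha <= enorm (grad (g i t) x) <= beta)
  (g_dt : forall i (t : R) x, t \in `[0, T] ->
     exists2 l : R, is_tderive T (fun s => g i s x : R^o) t l & `|l| <= beta)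
  (g_dt_grad : forall i (t : R) x, t \in `[0, T] -> U i t x ->
     (\forall s \near within `[0, T] (nbhs t),
        differentiable (g i s : 'rV[R]_d -> R^o) x) /\
     exists2 l : 'rV[R]_d,
       is_tderive T (fun s => grad (g i s) x) t l & enorm l <= M)
  (g_hess : forall i (t : R) x, t \in `[0, T] -> U i t x ->
     opnorm (hess (g i t) x) <= M)
  (gamma_ge1 : 1 <= gamma) (rho_gt0 : 0 < rho)
  (g_inverse_triangle : forall (t : R) x (lambda : 'I_p -> R),
     t \in `[0, T] -> Q g t x -> (forall i, 0 <= lambda i) ->
     \sum_(i < p | g i t x <= rho) lambda i * enorm (grad (g i t) x) <=
     gamma * enorm (\sum_(i < p | g i t x <= rho) lambda i *: grad (g i t) x))
  (f_measurable : borel_on T f)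
  (Kf_gt0 : 0 < Kf) (Lf_gt0 : 0 < Lf) (Hf_gt0 : 0 < Hf)
  (f_lipschitz : forall (t : R) x y, t \in `[0, T] ->
     (\bigcup_(tau in `[0, T]) Q g tau) x ->
     (\bigcup_(tau in `[0, T]) Q g tau) y ->
     enorm (f t x - f t y) <= Kf * enorm (x - y))
  (f_growth : forall (t : R) x, t \in `[0, T] ->
     (\bigcup_(tau in `[0, T]) Q g tau) x ->
     enorm (f t x) <= Lf * (1 + enorm x))
  (f_holder : forall (t s : R) x, t \in `[0, T] -> s \in `[0, T] ->
     (\bigcup_(tau in `[0, T]) Q g tau) x ->
     enorm (f t x - f s x) <= Hf * Num.sqrt `|t - s|)
  (q0_in : Q g 0 q0)
  (q_sol : sweeping_solution g f T q0 q) :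
  exists2 C0 : R, 0 < C0 &
    \forall n \near \oo,
      (Linfty_norm T (fun t => discrete_solution g f T q0 n t - q t)%R
         <= (C0 * Num.sqrt (T / n%:R))%:E)%E.
Proof.
have [q_ac _ _ _] := q_sol.
have [B B0 qB] := abs_continuous_bounded q_ac (ltW T_gt0).
have L0 : 0 < Qspeed alpha beta gamma by exact: Qspeed_gt0.
have r0 : 0 < tangent_radius c alpha beta M gamma rho by exact: tangent_radius_gt0.
have hh0 : 0 < Qtimescale alpha beta gamma rho by exact: Qtimescale_gt0.
exists (expR (error_rate T c alpha beta M gamma rho Kf Lf Hf q0 B * T)).
  exact: expR_gt0.
pose m := Num.min 1 (Num.min (Qtimescale alpha beta gamma rho)
  (tangent_radius c alpha beta M gamma rho / Qspeed alpha beta gamma)).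
have m0 : 0 < m by rewrite !lt_min ltr01 hh0 divr_gt0.
near=> n.
have n_gt : T / m < n%:R by near: n; exact: nbhs_infty_gtr.
have n0 : 0 < n%:R :> R by apply: lt_trans n_gt; rewrite divr_gt0.
have hm : T / n%:R <= m.
  by rewrite ler_pdivrMr// mulrC -ler_pdivrMr// ltW.
move: hm; rewrite !le_min => /andP[h1 /andP[hh hr]].
apply: Linfty_norm_le; last by rewrite mulr_ge0 ?expR_ge0 ?sqrtr_ge0.
move=> t tT; rewrite /discrete_solution.
have hn_gt0 : 0 < T / n%:R by rewrite divr_gt0.
have hLr : Qspeed alpha beta gamma * (T / n%:R) <= tangent_radius c alpha beta M gamma rho.
  by rewrite mulrC -ler_pdivlMr.
have nhT : n%:R * (T / n%:R) = T by rewrite mulrC divfK// gt_eqF.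
exact: (interpolate_error g_convex c_gt0 Q_dist_U alpha_gt0 beta_gt0 M_gt0 g_C2
  g_grad g_dt g_hess gamma_ge1 rho_gt0 g_inverse_triangle Kf_gt0 Lf_gt0 Hf_gt0
  f_lipschitz f_growth f_holder q0_in hn_gt0 h1 hh hLr nhT T_gt0 q_sol qB tT).
Unshelve. all: by end_near. Qed.
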